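(* Let $(A,\Phi)$ be an $\ell$CEDS, and let $\mathbf{PreLie}_\Phi$ be the operad of $\Phi$-prelie algebras. 1. The prelie products of $\mathbf{PreLie}_\Phi$ are the products $\circ_a$, where $a$ is a special vector of $(A,\Phi)$ of eigenvalue $1$. 2. The NAP products of $\mathbf{PreLie}_\Phi$ are the products $\circ_a$, where $a$ is a special vector of $(A,\Phi)$ of eigenvalue $0$.
   Context: $\mathbb{K}$ is a field of characteristic zero and all vector spaces are over $\mathbb{K}$; $\tau$ is the flip of $A\otimes A$. An $\ell$CEDS is a pair $(A,\Phi)$ with $A$ a vector space and $\Phi:A\otimes A\to A\otimes A$ linear such that $(\mathrm{Id}\otimes\Phi)\circ(\Phi\otimes\mathrm{Id})\circ(\mathrm{Id}\otimes\Phi)=(\Phi\otimes\mathrm{Id})\circ(\mathrm{Id}\otimes\tau)\circ(\Phi\otimes\mathrm{Id})$ and $(\mathrm{Id}\otimes\Phi)\circ(\mathrm{Id}\otimes\tau)\circ(\tau\otimes\mathrm{Id})\circ(\Phi\otimes\mathrm{Id})=(\tau\otimes\mathrm{Id})\circ(\Phi\otimes\mathrm{Id})\circ(\mathrm{Id}\otimes\Phi)\circ(\mathrm{Id}\otimes\tau)$. With the formal Sweedler notation $\Phi(a\otimes b)=\sum a'\rightarrow b'\otimes a''\triangleright b''$, a $\Phi$-prelie algebra is a vector space $V$ with products $\circ_a:V\otimes V\to V$, depending linearly on $a\in A$, such that for all $x,y,z\in V$, $a,b\in A$: $$x\circ_a(y\circ_b z)-\sum(x\circ_{a''\triangleright b''}y)\circ_{a'\rightarrow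 b'}z=y\circ_b(x\circ_a z)-\sum(y\circ_{b''\triangleright a''}x)\circ_{b'\rightarrow a'}z.$$ $\mathbf{PreLie}_\Phi$ is the (symmetric, binary quadratic) operad of $\Phi$-prelie algebras, generated by the elements $\circ_a\in\mathbf{PreLie}_\Phi(2)$. A vector $a\in A$ is a special vector of $(A,\Phi)$ of eigenvalue $\lambda\in\mathbb{K}$ if $\Phi(a\otimes a)=\lambda\,a\otimes a$. A prelie product of $\mathbf{PreLie}_\Phi$ is an element $p\in\mathbf{PreLie}_\Phi(2)$ such that, with $I$ the unit of the operad, $p\circ(I,p)-p\circ(p,I)=p\circ(I,p)^{(12)}-p\circ(p,I)^{(12)}$ (i.e. $p(x,p(y,z))-p(p(x,y),z)$ is symmetric in $x,y$); equivalently, the image of the generator under an operad morphism from the operad of (left) prelie algebras to $\mathbf{PreLie}_\Phi$. A NAP (non-associative permutative) product of $\mathbf{PreLie}_\Phi$ is an element $p\in\mathbf{PreLie}_\Phi(2)$ such that $p\circ(I,p)=p\circ(I,p)^{(12)}$ (i.e. $p(x,p(y,z))=p(y,p(x,z))$). *)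

(* Defs.v *)
From HB Require Import structures.
From mathcomp Require Import all_boot all_order all_algebra perm.
From mathcomp Require Import finmap boolp.
From mathcomp Require Import monalg.

Set Implicit Arguments.
Unset Strict Implicit.
Unset Printing Implicit Defensive.

Import GRing.Theory.
Local Open Scope ring_scope.

(* -------------------------------------------------------------------------- *)
Section FreeModule.
Variable K : fieldType.

(* The linear extension of f to the free module on T.                         *)
Definition free_lift (T : choiceType) (W : lmodType K) (f : T -> W)
    (p : {malg K[T]}) : W :=
  \sum_(t <- msupp p) p@_t *: f t.

Section Theory.
Variables (T : choiceType) (W : lmodType K).
Implicit Types (f : T -> W) (p : {malg K[T]}).

Lemma free_liftEw f p (d : {fset T}) : fsubset (msupp p) d ->
  free_lift f p = \sum_(t <- d) p@_t *: f t.
Proof.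
move=> sd; rewrite /free_lift (big_fset_incl _ sd) //= => t _ /mcoeff_outdom ->.
by rewrite scale0r.
Qed.

Lemma free_lift_is_linear f : linear (free_lift f).
Proof.
move=> c p q; pose d := fsetU (msupp (c *: p + q)) (fsetU (msupp p) (msupp q)).
rewrite !(@free_liftEw _ _ d) /d ?fsubsetUl //; last 2 first.
- by apply: (fsubset_trans (fsubsetUr (msupp p) _)); apply: fsubsetUr.
- by apply: (fsubset_trans (fsubsetUl _ (msupp q))); apply: fsubsetUr.
rewrite scaler_sumr -big_split /=; apply: eq_bigr => t _.
by rewrite mcoeffD mcoeffZ scalerDl scalerA.
Qed.

HB.instance Definition _ f :=
  GRing.isLinear.Build K {malg K[T]} W *:%R (free_lift f)
    (free_lift_is_linear f).

Lemma free_liftU f t : free_lift f << t >> = f t.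
Proof.
rewrite (@free_liftEw _ _ (fset1 t)) ?msuppU_le //.
by rewrite big_seq_fset1 mcoeffUU scale1r.
Qed.

Lemma malg_sum p : p = \sum_(t <- msupp p) p@_t *: << t >>.
Proof.
rewrite {1}[p]monalgE; apply: eq_bigr => t _; apply/malgP => u.
by rewrite mcoeffZ !mcoeffU mulrnAr mulr1.
Qed.

Lemma eq_linear_free (g h : {linear {malg K[T]} -> W}) :
  (forall t, g << t >> = h << t >>) -> g =1 h.
Proof.
move=> gh p; rewrite [p]malg_sum !linear_sum; apply: eq_bigr => t _.
by rewrite !linearZ /= gh.
Qed.

Lemma eq_free_lift f g p :
  {in msupp p, f =1 g} -> free_lift f p = free_lift g p.
Proof.
by move=> fg; rewrite /free_lift !big_seq; apply: eq_bigr => t /fg ->.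
Qed.

End Theory.

Lemma linear_free_lift (T : choiceType) (W W' : lmodType K) (f : T -> W)
    (g : {linear W -> W'}) p :
  g (free_lift f p) = free_lift (g \o f) p.
Proof.
by rewrite /free_lift linear_sum; apply: eq_bigr => t _; rewrite linearZ.
Qed.

End FreeModule.

(* -------------------------------------------------------------------------- *)
Section QuotientModule.
Variables (K : fieldType) (U : lmodType K).

Record submodule := Submodule {
  sm_pred :> U -> Prop;
  sm0 : sm_pred 0;
  smP : forall c u v, sm_pred u -> sm_pred v -> sm_pred (c *: u + v) }.

Inductive in_span (R : U -> Prop) : U -> Prop :=
| span_gen u : R u -> in_span R u
| span_0 : in_span R 0
| span_lin c u v : in_span R u -> in_span R v -> in_span R (c *: u + v).

Definition span R : submodule := Submodule (@span_0 R) (@span_lin R).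

Definition sm_bool (W : submodule) : {pred U} := fun u => `[< W u >].

Fact sm_bool_submod (W : submodule) : submod_closed (sm_bool W).
Proof.
split=> [|c u v]; first by apply/asboolP; apply: sm0.
by move=> /asboolP uW /asboolP vW; apply/asboolP; apply: smP.
Qed.

HB.instance Definition _ (W : submodule) :=
  GRing.isSubmodClosed.Build K U (sm_bool W) (sm_bool_submod W).

Definition quotmod (W : submodule) : Type := Quotient.quot (sm_bool W).

Section Inst.
Variable W : submodule.

HB.instance Definition _ := GRing.Zmodule.on (quotmod W).

Definition qpi (u : U) : quotmod W := \pi_(Quotient.quot (sm_bool W))%qT u.
Definition qrepr (x : quotmod W) : U :=
  repr (x : Quotient.quot (sm_bool W)).

Lemma qreprK : cancel qrepr qpi.
Proof. exact: reprK. Qed.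

Lemma qpiP u v : qpi u = qpi v <-> W (u - v).
Proof.
rewrite /qpi; split => [/eqP|uv].
  by rewrite -Quotient.idealrBE => /asboolP.
by apply/eqP; rewrite -Quotient.idealrBE; apply/asboolP.
Qed.

Lemma qrepr_pi u : W (qrepr (qpi u) - u).
Proof. by apply/qpiP; rewrite qreprK. Qed.

Lemma qpiD u v : qpi (u + v) = qpi u + qpi v.
Proof. exact: (raddfD (\pi_(Quotient.quot (sm_bool W))%qT)). Qed.

Lemma qpi0 : qpi 0 = 0.
Proof. exact: (raddf0 (\pi_(Quotient.quot (sm_bool W))%qT)). Qed.

Definition qscale (c : K) (x : quotmod W) : quotmod W := qpi (c *: qrepr x).

Lemma smZ c u : W u -> W (c *: u).
Proof. by move=> uW; rewrite -[c *: u]addr0; apply: smP => //; apply: sm0. Qed.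

Lemma qscale_pi c u : qscale c (qpi u) = qpi (c *: u).
Proof. by apply/qpiP; rewrite -scalerBr; apply: smZ; apply: qrepr_pi. Qed.

Fact qscaleA a b x : qscale a (qscale b x) = qscale (a * b) x.
Proof. by rewrite -[x]qreprK !qscale_pi scalerA. Qed.
Fact qscale1 : left_id 1 qscale.
Proof. by move=> x; rewrite -[x in LHS]qreprK qscale_pi scale1r qreprK. Qed.
Fact qscaleDr : right_distributive qscale +%R.
Proof.
move=> c x y; rewrite -[x]qreprK -[y]qreprK -qpiD !qscale_pi -qpiD.
by rewrite scalerDr.
Qed.
Fact qscaleDl x : {morph qscale^~ x : a b / a + b}.
Proof. by move=> a b; rewrite -[x]qreprK !qscale_pi -qpiD scalerDl. Qed.

HB.instance Definition _ := GRing.Zmodule_isLmodule.Build K (quotmod W)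
  qscaleA qscale1 qscaleDr qscaleDl.

Fact qpi_linear : linear qpi.
Proof. by move=> c u v; rewrite qpiD -qscale_pi. Qed.

HB.instance Definition _ := GRing.isLinear.Build K U (quotmod W) *:%R qpi
  qpi_linear.

End Inst.

End QuotientModule.

Arguments qpi {K U} W u.
Arguments in_span {K U} R _.
Arguments span {K U} R.

(* -------------------------------------------------------------------------- *)
Section Tensor.
Variable K : fieldType.

Inductive tensor_rel (U V : lmodType K) : {malg K[(U * V)%type]} -> Prop :=
| tensor_rel_l c u u' v :
    tensor_rel (<< (c *: u + u', v) >> - c *: << (u, v) >> - << (u', v) >>)
| tensor_rel_r c u v v' :
    tensor_rel (<< (u, c *: v + v') >> - c *: << (u, v) >> - << (u, v') >>).

Definition tensor (U V : lmodType K) : lmodType K :=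
  quotmod (span (@tensor_rel U V)).

Definition tens (U V : lmodType K) (u : U) (v : V) : tensor U V :=
  qpi _ << (u, v) >>.

(* The linear map induced by f; it is only meaningful when f is bilinear,      *)
(* see tlift_tens and tlift_linear.                                            *)
Definition tlift (U V W : lmodType K) (f : U -> V -> W) (t : tensor U V) : W :=
  free_lift (fun uv => f uv.1 uv.2) (qrepr t).

Definition bilin (U V W : lmodType K) (f : U -> V -> W) : Prop :=
  (forall v, linear (f^~ v)) /\ (forall u, linear (f u)).

Section Theory.
Variables U V W : lmodType K.

Lemma tens_bilin : bilin (@tens U V).
Proof.
split=> [v c u u'|u c v v'].
  apply: (etrans _ (qpi_linear _ c << (u, v) >> << (u', v) >>)).
  by apply/qpiP; rewrite opprD addrA; apply/span_gen/tensor_rel_l.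
apply: (etrans _ (qpi_linear _ c << (u, v) >> << (u, v') >>)).
by apply/qpiP; rewrite opprD addrA; apply/span_gen/tensor_rel_r.
Qed.

Lemma tlift_pi (f : U -> V -> W) p : bilin f ->
  tlift f (qpi _ p) = free_lift (fun uv => f uv.1 uv.2) p.
Proof.
move=> [fl fr]; apply/eqP; rewrite -subr_eq0 /tlift -linearB /=; apply/eqP.
move: (qrepr_pi (span (@tensor_rel U V)) p).
move: (qrepr _ - p) => r; elim=> {r} [r [c u u' v|c u v v']||c r s _ IHr _ IHs].
- by rewrite !linearB linearZ /= !free_liftU /= fl -addrA -opprD subrr.
- by rewrite !linearB linearZ /= !free_liftU /= fr -addrA -opprD subrr.
- by rewrite linear0.
- by rewrite linearP /= IHr IHs scaler0 addr0.
Qed.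

Lemma tlift_tens (f : U -> V -> W) u v : bilin f ->
  tlift f (tens u v) = f u v.
Proof. by move=> bf; rewrite tlift_pi // free_liftU. Qed.

Lemma tlift_linear (f : U -> V -> W) : bilin f -> linear (tlift f).
Proof.
move=> bf c x y; rewrite -[x]qreprK -[y]qreprK -qpi_linear !tlift_pi //.
by rewrite linearP.
Qed.

Lemma tensor_sum (t : tensor U V) :
  exists s : seq (U * V), t = \sum_(uv <- s) tens uv.1 uv.2.
Proof.
rewrite -[t]qreprK [qrepr t]malg_sum linear_sum.
exists [seq ((qrepr t)@_uv *: uv.1, uv.2) | uv <- msupp (qrepr t)].
rewrite big_map; apply: eq_bigr => -[u v] _ /=; rewrite linearZ /=.
have bl := tens_bilin.1 v; have t0 : tens 0 v = 0 :> tensor U V.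
  move: (bl 1 0 0) => /=; rewrite !scale1r addr0.
  by move/(congr1 (fun x => x - tens 0 v)); rewrite addrK subrr.
by move: (bl (qrepr t)@_(u, v) u 0) => /=; rewrite t0 !addr0.
Qed.

End Theory.

Definition tmap (U U' V V' : lmodType K) (f : U -> U') (g : V -> V') :
    tensor U V -> tensor U' V' :=
  tlift (fun u v => tens (f u) (g v)).

Definition tassoc (U V W : lmodType K) :
    tensor (tensor U V) W -> tensor U (tensor V W) :=
  tlift (fun t w => tlift (fun u v => tens u (tens v w)) t).

Definition tassocV (U V W : lmodType K) :
    tensor U (tensor V W) -> tensor (tensor U V) W :=
  tlift (fun u t => tlift (fun v w => tens (tens u v) w) t).

Definition tflip (U V : lmodType K) : tensor U V -> tensor V U :=
  tlift (fun u v => tens v u).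

End Tensor.

(* -------------------------------------------------------------------------- *)
Section lCEDS.
Variables (K : fieldType) (A : lmodType K).
Implicit Types F : tensor A A -> tensor A A.

(* A (x) A (x) A is realized as A (x) (A (x) A), whence the associativity      *)
(* isomorphisms in the definition of F (x) Id.                                 *)
Definition id_tens F : tensor A (tensor A A) -> tensor A (tensor A A) :=
  tmap id F.
Definition tens_id F : tensor A (tensor A A) -> tensor A (tensor A A) :=
  @tassoc _ A A A \o tmap F id \o @tassocV _ A A A.

Local Notation tau := (@tflip _ A A).

Definition lCEDS (Phi : {linear tensor A A -> tensor A A}) : Prop :=
  id_tens Phi \o tens_id Phi \o id_tens Phi
    =1 tens_id Phi \o id_tens tau \o tens_id Phi
  /\
  id_tens Phi \o id_tens tau \o tens_id tau \o tens_id Phi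
    =1 tens_id tau \o tens_id Phi \o id_tens Phi \o id_tens tau.

Definition special_vector (Phi : {linear tensor A A -> tensor A A})
    (lambda : K) (a : A) : Prop :=
  Phi (tens a a) = lambda *: tens a a.

End lCEDS.

(* -------------------------------------------------------------------------- *)
(* Symmetric operads over K, in coordinate-free form: P I is the space of      *)
(* operations whose inputs are labelled by the finite set I, so that           *)
(* P(n) = P 'I_n. A bijection f : I -> J relabels inputs (for I = J = 'I_n     *)
(* this is the action of the symmetric group), and op_comp p q plugs q i into  *)
(* the input i of p, for all i.                                                *)
Record operad (K : fieldType) := Operad {
  op_obj :> finType -> lmodType K;
  op_act : forall (I J : finType) (f : I -> J),
    bijective f -> op_obj I -> op_obj J;
  op_id : op_obj 'I_1;
  op_comp : forall (I : finType) (J : I -> finType),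
    op_obj I -> (forall i, op_obj (J i)) -> op_obj {i : I & J i};
  op_act_linear : forall I J f bf, linear (@op_act I J f bf);
  op_act_id : forall (I : finType) (f : I -> I) (bf : bijective f) p,
    f =1 id -> op_act bf p = p;
  op_act_comp : forall (I J L : finType) (f : I -> J) (g : J -> L)
    (h : I -> L) (bf : bijective f) (bg : bijective g) (bh : bijective h) p,
    h =1 g \o f -> op_act bg (op_act bf p) = op_act bh p;
  op_comp_linear_l : forall (I : finType) (J : I -> finType)
    (q : forall i, op_obj (J i)), linear (fun p => op_comp p q);
  op_comp_linear_r : forall (I : finType) (J : I -> finType) (p : op_obj I)
    (q : forall i, op_obj (J i)) (i : I),
    linear (fun x : op_obj (J i) => op_comp p (dfwith q x));
  op_comp_act_l : forall (I I' : finType) (J : I' -> finType) (f : I -> I')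
    (bf : bijective f)
    (bh : bijective (fun u : {i : I & J (f i)} =>
                       existT J (f (projT1 u)) (projT2 u)))
    (p : op_obj I) (q : forall i, op_obj (J i)),
    op_comp (op_act bf p) q = op_act bh (op_comp p (fun i => q (f i)));
  op_comp_act_r : forall (I : finType) (J J' : I -> finType)
    (g : forall i, J i -> J' i) (bg : forall i, bijective (g i))
    (bh : bijective (fun u : {i : I & J i} =>
                       existT J' (projT1 u) (g (projT1 u) (projT2 u))))
    (p : op_obj I) (q : forall i, op_obj (J i)),
    op_comp p (fun i => op_act (bg i) (q i)) = op_act bh (op_comp p q);
  op_comp_id_l : forall (I : finType)
    (bf : bijective (fun u : {_ : 'I_1 & I} => projT2 u)) (p : op_obj I),
    op_act bf (op_comp op_id (fun _ => p)) = p;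
  op_comp_id_r : forall (I : finType)
    (bf : bijective (fun u : {_ : I & 'I_1} => projT1 u)) (p : op_obj I),
    op_act bf (op_comp p (fun _ => op_id)) = p;
  op_comp_assoc : forall (I : finType) (J : I -> finType)
    (L : forall i, J i -> finType)
    (bh : bijective (fun w : {u : {i : I & J i} & L (projT1 u) (projT2 u)} =>
       existT (fun i => {j : J i & L i j}) (projT1 (projT1 w))
         (existT (L (projT1 (projT1 w))) (projT2 (projT1 w)) (projT2 w))))
    (p : op_obj I) (q : forall i, op_obj (J i))
    (r : forall i (j : J i), op_obj (L i j)),
    op_act bh (op_comp (op_comp p q) (fun u => r (projT1 u) (projT2 u)))
      = op_comp p (fun i => op_comp (q i) (r i)) }.

Arguments op_act {K o I J f} bf p.
Arguments op_id {K o}.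
Arguments op_comp {K o I J} p q.

Section OperadLinearity.
Variables (K : fieldType) (P : operad K).

Lemma op_compPl (I : finType) (J : I -> finType) (q : forall i, P (J i)) c
    (x y : P I) :
  op_comp (c *: x + y) q = c *: op_comp x q + op_comp y q.
Proof. exact: (op_comp_linear_l q). Qed.

Lemma op_compPr (I : finType) (J : I -> finType) (p : P I)
    (q : forall i, P (J i)) (i : I) c (x y : P (J i)) :
  op_comp p (dfwith q (c *: x + y))
    = c *: op_comp p (dfwith q x) + op_comp p (dfwith q y).
Proof. exact: (op_comp_linear_r p q). Qed.

Lemma op_compBl (I : finType) (J : I -> finType) (q : forall i, P (J i))
    (x y : P I) :
  op_comp (x - y) q = op_comp x q - op_comp y q.
Proof. by rewrite addrC -scaleN1r op_compPl scaleN1r addrC. Qed.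

Lemma op_compBr (I : finType) (J : I -> finType) (p : P I)
    (q : forall i, P (J i)) (i : I) (x y : P (J i)) :
  op_comp p (dfwith q (x - y))
    = op_comp p (dfwith q x) - op_comp p (dfwith q y).
Proof. by rewrite addrC -scaleN1r op_compPr scaleN1r addrC. Qed.

Lemma op_actB (I J : finType) (f : I -> J) (bf : bijective f) (x y : P I) :
  op_act bf (x - y) = op_act bf x - op_act bf y.
Proof. by rewrite addrC -scaleN1r op_act_linear scaleN1r addrC. Qed.

End OperadLinearity.

(* -------------------------------------------------------------------------- *)
Section BinaryComposition.
Variables (K : fieldType) (P : operad K).

Definition pair_fam (T : Type) (x y : T) (i : 'I_2) : T :=
  if i == ord0 then x else y.

Definition pair_op (I J : finType) (q : P I) (r : P J) (i : 'I_2) :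
    P (pair_fam I J i) :=
  if i == ord0 as b return P (if b then I else J) then q else r.

(* The inputs of the first operation come first.                               *)
Definition flat2 m n (u : {i : 'I_2 & pair_fam ('I_m : finType) 'I_n i}) :
    'I_(m + n) :=
  (if projT1 u == ord0 as b
     return Finite.sort (if b then 'I_m : finType else 'I_n) -> 'I_(m + n)
   then @lshift m n else @rshift m n) (projT2 u).

Definition unflat2 m n (k : 'I_(m + n)) :
    {i : 'I_2 & pair_fam ('I_m : finType) 'I_n i} :=
  match split k with
  | inl j => existT (pair_fam ('I_m : finType) 'I_n) ord0 j
  | inr j => existT (pair_fam ('I_m : finType) 'I_n) ord_max j
  end.

Fact flat2_bij m n : bijective (@flat2 m n).
Proof.
exists (@unflat2 m n) => [|k]; last first.
  by rewrite /unflat2; case: splitP => j kj; apply: val_inj; rewrite /= kj.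
case=> i u; have [i0|i1] : i = ord0 \/ i = ord_max.
- by case: i {u} => -[|[|k]] // lti; [left | right]; apply: val_inj.
- by subst i; rewrite /unflat2 /flat2 /= (unsplitK (inl u)).
by subst i; rewrite /unflat2 /flat2 /= (unsplitK (inr u)).
Qed.

Definition op_comp2 (m n : nat) (p : P 'I_2) (q : P 'I_m) (r : P 'I_n) :
    P 'I_(m + n) :=
  op_act (flat2_bij m n) (op_comp p (pair_op q r)).

(* p o (I, q), that is p(x, q(y, z)), and p o (q, I), that is p(q(x, y), z)    *)
Definition op_comp_id_op (p q : P 'I_2) : P 'I_3 := @op_comp2 1 2 p op_id q.
Definition op_comp_op_id (p q : P 'I_2) : P 'I_3 := @op_comp2 2 1 p q op_id.

Definition swap12 : 'I_3 -> 'I_3 := tperm (inord 0) (inord 1).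

Fact swap12_bij : bijective swap12.
Proof. by exists swap12 => i; rewrite /swap12 tpermK. Qed.

Definition op_act12 : P 'I_3 -> P 'I_3 := op_act swap12_bij.

Definition prelie_product (p : P 'I_2) : Prop :=
  op_comp_id_op p p - op_comp_op_id p p
    = op_act12 (op_comp_id_op p p) - op_act12 (op_comp_op_id p p).

Definition NAP_product (p : P 'I_2) : Prop :=
  op_comp_id_op p p = op_act12 (op_comp_id_op p p).

End BinaryComposition.

(* -------------------------------------------------------------------------- *)
Section QuotientOperad.
Variables (K : fieldType) (P : operad K) (R : forall I : finType, P I -> Prop).

(* The operadic ideal generated by R.                                          *)
Inductive op_ideal : forall I : finType, P I -> Prop :=
| ideal_gen (I : finType) (p : P I) : R p -> op_ideal p
| ideal_0 (I : finType) : op_ideal (0 : P I)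
| ideal_lin (I : finType) c (p q : P I) :
    op_ideal p -> op_ideal q -> op_ideal (c *: p + q)
| ideal_act (I J : finType) (f : I -> J) (bf : bijective f) (p : P I) :
    op_ideal p -> op_ideal (op_act bf p)
| ideal_comp_l (I : finType) (J : I -> finType) (p : P I)
    (q : forall i, P (J i)) :
    op_ideal p -> op_ideal (op_comp p q)
| ideal_comp_r (I : finType) (J : I -> finType) (p : P I)
    (q : forall i, P (J i)) (i : I) :
    op_ideal (q i) -> op_ideal (op_comp p q).

Definition ideal_sm (I : finType) : submodule (P I) :=
  Submodule (@ideal_0 I) (@ideal_lin I).

Definition qop (I : finType) : lmodType K := quotmod (ideal_sm I).

Definition qop_pi (I : finType) (p : P I) : qop I := qpi (ideal_sm I) p.

Definition qop_act (I J : finType) (f : I -> J) (bf : bijective f)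
    (p : qop I) : qop J :=
  qop_pi (op_act bf (qrepr p)).

Definition qop_id : qop 'I_1 := qop_pi op_id.

Definition qop_comp (I : finType) (J : I -> finType) (p : qop I)
    (q : forall i, qop (J i)) : qop {i : I & J i} :=
  qop_pi (op_comp (qrepr p) (fun i => qrepr (q i))).

Fact qop_act_pi I J f (bf : bijective f) p :
  @qop_act I J f bf (qop_pi p) = qop_pi (op_act bf p).
Proof.
apply/qpiP; move: (qrepr_pi (ideal_sm I) p) => /(ideal_act bf) /=.
by rewrite op_actB.
Qed.

Lemma dfwith_same (I : eqType) (T : I -> Type) (q : forall i, T i) i :
  dfwith q (q i) = q.
Proof.
apply: functional_extensionality_dep => j.
by have [->|ji] := eqVneq i j; [rewrite dfwith_in | rewrite dfwith_out].
Qed.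

Lemma dfwith_dfwith (I : eqType) (T : I -> Type) (q : forall i, T i) i
    (x y : T i) : dfwith (dfwith q x) y = dfwith q y.
Proof.
apply: functional_extensionality_dep => j.
have [<-|ij] := eqVneq i j; first by rewrite !dfwith_in.
by rewrite !dfwith_out.
Qed.

Fact ideal_congr (I : finType) (J : I -> finType) (p p' : P I)
    (q q' : forall i, P (J i)) :
  op_ideal (p - p') -> (forall i, op_ideal (q i - q' i)) ->
  op_ideal (op_comp p q - op_comp p' q').
Proof.
have idD (L : finType) (x y : P L) : op_ideal x -> op_ideal y ->
    op_ideal (x + y).
  by move=> ix iy; rewrite -[x]scale1r; apply: ideal_lin.
move=> ip iq; rewrite -(subrK (op_comp p' q) (op_comp p q)) -addrA.
apply: (idD _); first by rewrite -op_compBl; apply: ideal_comp_l.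
pose mix (s : seq I) i := if i \in s then q' i else q i.
suff mixP s : op_ideal (op_comp p' q - op_comp p' (mix s)).
  have -> : q' = mix (enum I).
    by apply: functional_extensionality_dep => i; rewrite /mix mem_enum.
  exact: mixP.
elim: s => [|i s IHs].
  have -> : mix [::] = q by apply: functional_extensionality_dep => i.
  by rewrite subrr; apply: ideal_0.
rewrite -(subrK (op_comp p' (mix s)) (op_comp p' q)) -addrA; apply: (idD _) => //.
have -> : mix (i :: s) = dfwith (mix s) (q' i).
  apply: functional_extensionality_dep => j; rewrite /mix in_cons.
  have [<-|ij] := eqVneq i j; first by rewrite dfwith_in ?eqxx.
  by rewrite dfwith_out // eq_sym (negPf ij).
rewrite -[in X in op_ideal (X - _)](dfwith_same (mix s) i).
rewrite -op_compBr; apply: (@ideal_comp_r _ _ _ _ i); rewrite dfwith_in /mix.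
by case: ifP => // _; rewrite subrr; apply: ideal_0.
Qed.

Fact qop_comp_pi (I : finType) (J : I -> finType) (p : P I)
    (q : forall i, P (J i)) :
  qop_comp (qop_pi p) (fun i => qop_pi (q i)) = qop_pi (op_comp p q).
Proof. by apply/qpiP/ideal_congr => [|i]; apply: (qrepr_pi (ideal_sm _)). Qed.

Lemma qop_piK (I : finType) (p : qop I) : qop_pi (qrepr p) = p.
Proof. exact: qreprK. Qed.

Lemma qop_fam (I : finType) (J : I -> finType) (q : forall i, qop (J i)) :
  exists q' : forall i, P (J i), q = fun i => qop_pi (q' i).
Proof.
exists (fun i => qrepr (q i)).
by apply: functional_extensionality_dep => i; rewrite qop_piK.
Qed.

Lemma qop_pi_linear I : linear (@qop_pi I).
Proof. exact: qpi_linear. Qed.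

Fact qop_act_linear I J f bf : linear (@qop_act I J f bf).
Proof.
move=> c p q; rewrite -[p]qop_piK -[q]qop_piK -qop_pi_linear !qop_act_pi.
by rewrite op_act_linear qop_pi_linear.
Qed.

Fact qop_act_id (I : finType) (f : I -> I) (bf : bijective f) p :
  f =1 id -> qop_act bf p = p.
Proof.
by move=> fid; rewrite -[p]qop_piK qop_act_pi op_act_id.
Qed.

Fact qop_act_comp (I J L : finType) (f : I -> J) (g : J -> L)
    (h : I -> L) (bf : bijective f) (bg : bijective g) (bh : bijective h) p :
  h =1 g \o f -> qop_act bg (qop_act bf p) = qop_act bh p.
Proof.
move=> hgf; rewrite -[p]qop_piK !qop_act_pi; congr qop_pi.
exact: op_act_comp.
Qed.

Fact qop_comp_linear_l (I : finType) (J : I -> finType)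
  (q : forall i, qop (J i)) : linear (fun p => qop_comp p q).
Proof.
have [q' ->] := qop_fam q; move=> c x y.
rewrite -[x]qop_piK -[y]qop_piK -qop_pi_linear !qop_comp_pi.
by rewrite op_compPl qop_pi_linear.
Qed.

Lemma dfwith_pi (I : finType) (J : I -> finType) (q : forall i, P (J i)) i
    (x : P (J i)) :
  dfwith (fun i => qop_pi (q i)) (qop_pi x)
    = fun j => qop_pi (dfwith q x j).
Proof.
apply: functional_extensionality_dep => j.
have [<-|ij] := eqVneq i j; first by rewrite !dfwith_in.
by rewrite !dfwith_out.
Qed.

Fact qop_comp_linear_r (I : finType) (J : I -> finType) (p : qop I)
    (q : forall i, qop (J i)) (i : I) :
  linear (fun x : qop (J i) => qop_comp p (dfwith q x)).
Proof.
have [q' ->] := qop_fam q; move=> c x y.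
rewrite -[p]qop_piK -[x]qop_piK -[y]qop_piK -qop_pi_linear !dfwith_pi.
by rewrite !qop_comp_pi op_compPr qop_pi_linear.
Qed.

Fact qop_comp_act_l (I I' : finType) (J : I' -> finType) (f : I -> I')
    (bf : bijective f)
    (bh : bijective (fun u : {i : I & J (f i)} =>
                       existT J (f (projT1 u)) (projT2 u)))
    (p : qop I) (q : forall i, qop (J i)) :
  qop_comp (qop_act bf p) q = qop_act bh (qop_comp p (fun i => q (f i))).
Proof.
have [q' ->] := qop_fam q; rewrite -[p]qop_piK qop_act_pi.
rewrite (qop_comp_pi _ q') (qop_comp_pi _ (fun i => q' (f i))) qop_act_pi.
by rewrite (op_comp_act_l _ bh).
Qed.

Fact qop_comp_act_r (I : finType) (J J' : I -> finType)
    (g : forall i, J i -> J' i) (bg : forall i, bijective (g i))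
    (bh : bijective (fun u : {i : I & J i} =>
                       existT J' (projT1 u) (g (projT1 u) (projT2 u))))
    (p : qop I) (q : forall i, qop (J i)) :
  qop_comp p (fun i => qop_act (bg i) (q i)) = qop_act bh (qop_comp p q).
Proof.
have [q' ->] := qop_fam q; rewrite -[p]qop_piK qop_comp_pi qop_act_pi.
have -> : (fun i => qop_act (bg i) (qop_pi (q' i)))
        = (fun i => qop_pi (op_act (bg i) (q' i))).
  by apply: functional_extensionality_dep => i; rewrite qop_act_pi.
by rewrite qop_comp_pi (op_comp_act_r bg bh).
Qed.

Fact qop_comp_id_l (I : finType)
    (bf : bijective (fun u : {_ : 'I_1 & I} => projT2 u)) (p : qop I) :
  qop_act bf (qop_comp qop_id (fun _ => p)) = p.
Proof.
rewrite -[p]qop_piK (qop_comp_pi _ (fun _ => qrepr p)) qop_act_pi.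
by rewrite op_comp_id_l.
Qed.

Fact qop_comp_id_r (I : finType)
    (bf : bijective (fun u : {_ : I & 'I_1} => projT1 u)) (p : qop I) :
  qop_act bf (qop_comp p (fun _ => qop_id)) = p.
Proof.
rewrite -[p]qop_piK (qop_comp_pi _ (fun _ => op_id)) qop_act_pi.
by rewrite op_comp_id_r.
Qed.

Fact qop_comp_assoc (I : finType) (J : I -> finType)
    (L : forall i, J i -> finType)
    (bh : bijective (fun w : {u : {i : I & J i} & L (projT1 u) (projT2 u)} =>
       existT (fun i => {j : J i & L i j}) (projT1 (projT1 w))
         (existT (L (projT1 (projT1 w))) (projT2 (projT1 w)) (projT2 w))))
    (p : qop I) (q : forall i, qop (J i))
    (r : forall i (j : J i), qop (L i j)) :
  qop_act bh (qop_comp (qop_comp p q) (fun u => r (projT1 u) (projT2 u)))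
    = qop_comp p (fun i => qop_comp (q i) (r i)).
Proof.
have [q' ->] := qop_fam q; rewrite -[p]qop_piK qop_comp_pi.
pose r' i (j : J i) := qrepr (r i j).
have -> : r = fun i j => qop_pi (r' i j).
  apply: functional_extensionality_dep => i.
  by apply: functional_extensionality_dep => j; rewrite qop_piK.
rewrite (qop_comp_pi _ (fun u => r' (projT1 u) (projT2 u))) qop_act_pi.
have -> : (fun i => qop_comp (qop_pi (q' i)) (fun j => qop_pi (r' i j)))
        = (fun i => qop_pi (op_comp (q' i) (r' i))).
  by apply: functional_extensionality_dep => i; rewrite qop_comp_pi.
by rewrite qop_comp_pi op_comp_assoc.
Qed.

Definition quot_operad : operad K :=
  Operad qop_act_linear qop_act_id qop_act_comp qop_comp_linear_l
    qop_comp_linear_r qop_comp_act_l qop_comp_act_r qop_comp_id_l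
    qop_comp_id_r qop_comp_assoc.

Lemma qop_comp2_pi m n (p : P 'I_2) (q : P 'I_m) (r : P 'I_n) :
  @op_comp2 _ quot_operad m n (qop_pi p) (qop_pi q) (qop_pi r)
    = qop_pi (op_comp2 p q r).
Proof.
rewrite /op_comp2 /= -qop_act_pi -qop_comp_pi; congr (qop_act _ (qop_comp _ _)).
apply: functional_extensionality_dep => i; rewrite /pair_op /pair_fam.
by case: (i == ord0).
Qed.

End QuotientOperad.

(* -------------------------------------------------------------------------- *)
Section Trees.
Variable A : choiceType.

Inductive tree (X : Type) : Type :=
| Leaf (x : X)
| Node (a : A) (l r : tree X).

Fixpoint leaves X (t : tree X) : seq X :=
  match t with
  | Leaf x => [:: x]
  | Node _ l r => leaves l ++ leaves r
  end.

Fixpoint tree_map X Y (f : X -> Y) (t : tree X) : tree Y :=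
  match t with
  | Leaf x => Leaf (f x)
  | Node a l r => Node a (tree_map f l) (tree_map f r)
  end.

Section Encoding.
Variable X : choiceType.

Fixpoint tree_enc (t : tree X) : GenTree.tree (A + X) :=
  match t with
  | Leaf x => GenTree.Leaf (inr x)
  | Node a l r => GenTree.Node 0 [:: GenTree.Leaf (inl a); tree_enc l; tree_enc r]
  end.

Fixpoint tree_dec (t : GenTree.tree (A + X)) : option (tree X) :=
  match t with
  | GenTree.Leaf (inr x) => Some (Leaf x)
  | GenTree.Node 0 [:: GenTree.Leaf (inl a); l; r] =>
      if (tree_dec l, tree_dec r) is (Some l', Some r')
      then Some (Node a l' r') else None
  | _ => None
  end.

Lemma tree_encK : pcancel tree_enc tree_dec.
Proof. by elim=> //= a l -> r ->. Qed.

HB.instance Definition _ := Choice.copy (tree X) (pcan_type tree_encK).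

End Encoding.
End Trees.

Arguments Leaf {A X} x.
Arguments Node {A X} a l r.

(* -------------------------------------------------------------------------- *)
Section TreeModule.
Variables (K : fieldType) (A : choiceType).

Local Notation F X := {malg K[tree A X]}.

Lemma malg_ind (T : choiceType) (Q : {malg K[T]} -> Prop) :
  Q 0 -> (forall c t p, Q p -> Q (c *: << t >> + p)) -> forall p, Q p.
Proof.
move=> Q0 QS p; rewrite [p]malg_sum.
by elim: (enum_fset _) => [|t s IHs]; rewrite ?big_nil // big_cons; apply: QS.
Qed.

Section Defs.
Variables X Y : choiceType.

Definition node (a : A) (p q : F X) : F X :=
  free_lift (fun s => free_lift (fun t => << Node a s t >>) q) p.

Definition relabel (f : X -> Y) (p : F X) : F Y :=
  free_lift (fun t => << tree_map f t >>) p.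

End Defs.

Fixpoint subst (X Y : choiceType) (q : X -> F Y) (t : tree A X) : F Y :=
  match t with
  | Leaf x => q x
  | Node a l r => node a (subst q l) (subst q r)
  end.

Definition graft (X Y : choiceType) (q : X -> F Y) (p : F X) : F Y :=
  free_lift (subst q) p.

Lemma graft_linear (X Y : choiceType) (q : X -> F Y) : linear (graft q).
Proof. exact: free_lift_is_linear. Qed.

HB.instance Definition _ (X Y : choiceType) (q : X -> F Y) :=
  GRing.isLinear.Build K (F X) (F Y) *:%R (graft q) (graft_linear q).

Lemma graftU (X Y : choiceType) (q : X -> F Y) t : graft q << t >> = subst q t.
Proof. exact: free_liftU. Qed.

Lemma nodeU (X : choiceType) a (s t : tree A X) :
  node a << s >> << t >> = << Node a s t >>.
Proof. by rewrite /node !free_liftU. Qed.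

Lemma nodePl (X : choiceType) a c (p p' q : F X) :
  node a (c *: p + p') q = c *: node a p q + node a p' q.
Proof. exact: free_lift_is_linear. Qed.

Lemma nodePr (X : choiceType) a c (p q q' : F X) :
  node a p (c *: q + q') = c *: node a p q + node a p q'.
Proof.
rewrite /node /free_lift scaler_sumr -big_split; apply: eq_bigr => s _ /=.
rewrite -[X in _ *: X]/(free_lift _ _) free_lift_is_linear scalerDr.
by rewrite !scalerA mulrC.
Qed.

Lemma node0l (X : choiceType) a (q : F X) : node a 0 q = 0.
Proof. by rewrite /node /free_lift msupp0 big_seq_fset0. Qed.

Lemma node0r (X : choiceType) a (p : F X) : node a p 0 = 0.
Proof.
rewrite /node /free_lift big1 // => s _.
by rewrite msupp0 big_seq_fset0 scaler0.
Qed.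

Lemma graft0 (X Y : choiceType) (q : X -> F Y) : graft q 0 = 0.
Proof. by rewrite /graft /free_lift msupp0 big_seq_fset0. Qed.

Lemma graftPU (X Y : choiceType) (q : X -> F Y) c t p :
  graft q (c *: << t >> + p) = c *: subst q t + graft q p.
Proof. by rewrite (graft_linear q c << t >> p) graftU. Qed.

Lemma graft_node (X Y : choiceType) (r : X -> F Y) a (p q : F X) :
  graft r (node a p q) = node a (graft r p) (graft r q).
Proof.
elim/malg_ind: p => [|c s p IHp]; first by rewrite node0l graft0 node0l.
rewrite (nodePl a c << s >> p) (graftPU r c s p) (nodePl a c (subst r s)).
rewrite -IHp (graft_linear r c (node a << s >> q) (node a p q)).
suff -> : graft r (node a << s >> q) = node a (subst r s) (graft r q) by [].
move: {IHp} q; elim/malg_ind => [|d t q IHq]; first by rewrite node0r graft0 node0r.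
rewrite (nodePr a d << s >> << t >> q) (graftPU r d t q).
rewrite (nodePr a d (subst r s) (subst r t)) -IHq.
rewrite (graft_linear r d (node a << s >> << t >>) (node a << s >> q)).
by rewrite nodeU graftU.
Qed.

Lemma graft_graft (X Y Z : choiceType) (r : Y -> F Z) (q : X -> F Y) p :
  graft r (graft q p) = graft (fun x => graft r (q x)) p.
Proof.
have subst_graft t : graft r (subst q t) = subst (fun x => graft r (q x)) t.
  by elim: t => //= a s IHs t IHt; rewrite graft_node IHs IHt.
elim/malg_ind: p => [|c t p IHp]; first by rewrite !graft0.
rewrite (graftPU q c t p) (graftPU _ c t p) -IHp -subst_graft.
exact: (graft_linear r c (subst q t) (graft q p)).
Qed.

Lemma relabelE (X Y : choiceType) (f : X -> Y) p :
  relabel f p = graft (fun x => << Leaf (f x) >>) p.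
Proof.
apply: eq_free_lift => t _; elim: t => //= a s IHs t IHt.
by rewrite -IHs -IHt nodeU.
Qed.

Lemma relabel_linear (X Y : choiceType) (f : X -> Y) : linear (relabel f).
Proof. exact: free_lift_is_linear. Qed.

Lemma graft_id (X : choiceType) (p : F X) :
  graft (fun x => << Leaf x >>) p = p.
Proof.
have subst_id t : subst (fun x : X => << Leaf x >>) t = << t >>.
  by elim: t => //= a s -> t ->; rewrite nodeU.
elim/malg_ind: p => [|c t p IHp]; first by rewrite graft0.
by rewrite (graftPU _ c t p) IHp subst_id.
Qed.

Lemma eq_subst (X Y : choiceType) (q q' : X -> F Y) t :
  {in leaves t, q =1 q'} -> subst q t = subst q' t.
Proof.
elim: t => [x|a s IHs t IHt] /= qq'; first by apply: qq'; rewrite inE.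
by rewrite IHs 1?IHt // => x xst; apply: qq'; rewrite mem_cat xst ?orbT.
Qed.

Lemma eq_graft (X Y : choiceType) (q q' : X -> F Y) p :
  q =1 q' -> graft q p = graft q' p.
Proof. by move=> qq'; apply: eq_free_lift => t _; apply: eq_subst => x _. Qed.

Lemma subst_multilinear (X Y : choiceType) (f g h : X -> F Y) x c t :
  (forall y, y != x -> f y = g y /\ f y = h y) ->
  f x = c *: g x + h x ->
  count_mem x (leaves t) = 1 ->
  subst f t = c *: subst g t + subst h t.
Proof.
move=> fgh fx; elim: t => [y|a s IHs t IHt] /=.
  by have [->|] := eqVneq y x.
have nx (k : X -> F Y) u : (forall y, y != x -> f y = k y) ->
    count_mem x (leaves u) = 0 -> subst f u = subst k u.
  move=> fk /eqP; rewrite -leqn0 leqNgt -has_count has_pred1 => xu.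
  by apply: eq_subst => y yu; apply: fk; apply: contraNneq xu => <-.
have fg y : y != x -> f y = g y by move/fgh=> [].
have fh y : y != x -> f y = h y by move/fgh=> [].
rewrite count_cat; case sE : (count_mem x (leaves s)) => [|[|n]] //.
  rewrite add0n => tE; have gE := nx g s fg sE; have hE := nx h s fh sE.
  by rewrite (IHt tE) (nodePr a c (subst f s)) {1}gE hE.
case tE : (count_mem x (leaves t)) => [|n] // _.
have gE := nx g t fg tE; have hE := nx h t fh tE.
by rewrite (IHs sE) (nodePl a c (subst g s)) {1}gE hE.
Qed.

(* p is a combination of trees whose leaves are labelled by s (in some order)  *)
Definition labelled_by (X : choiceType) (s : seq X) : {pred F X} :=
  fun p => all (fun t => perm_eq (leaves t) s) (msupp p).

Section Labels.
Variables (X : choiceType) (s : seq X).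

Lemma labelledP (p : F X) :
  reflect {in msupp p, forall t, perm_eq (leaves t) s} (p \in labelled_by s).
Proof. exact: allP. Qed.

Fact labelled_submod : submod_closed (labelled_by s).
Proof.
split=> [|c p q /labelledP lp /labelledP lq].
  by apply/labelledP => t; rewrite msupp0.
apply/labelledP => t /(fsubsetP (msuppD_le _ _)); rewrite in_fsetU.
by case/orP => [/(fsubsetP (msuppZ_le _ _))/lp|/lq].
Qed.

HB.instance Definition _ :=
  GRing.isSubmodClosed.Build K (F X) (labelled_by s) labelled_submod.

Lemma labelledU t : perm_eq (leaves t) s -> << t >> \in labelled_by s.
Proof.
by move=> ts; apply/labelledP => u /(fsubsetP msuppU_le); rewrite inE => /eqP->.
Qed.

Lemma labelled_lift (T : choiceType) (f : T -> F X) p :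
  {in msupp p, forall t, f t \in labelled_by s} ->
  free_lift f p \in labelled_by s.
Proof.
move=> fs; rewrite /free_lift big_seq; apply: rpred_sum => t tp.
by apply: rpredZ; apply: fs.
Qed.

End Labels.

Lemma perm_labelled (X : choiceType) (s s' : seq X) : perm_eq s s' ->
  labelled_by s =i labelled_by s'.
Proof.
by move=> ss' p; apply: eq_all => t; rewrite (permPr ss').
Qed.

Lemma labelled_node (X : choiceType) (s s' : seq X) a p q :
  p \in labelled_by s -> q \in labelled_by s' ->
  node a p q \in labelled_by (s ++ s').
Proof.
move=> /labelledP ps /labelledP qs; apply: labelled_lift => t tp.
by apply: labelled_lift => u uq; apply: labelledU; rewrite perm_cat ?ps ?qs.
Qed.

Lemma labelled_subst (X Y : choiceType) (s : X -> seq Y) (q : X -> F Y) t :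
  (forall x, q x \in labelled_by (s x)) ->
  subst q t \in labelled_by (flatten [seq s x | x <- leaves t]).
Proof.
move=> qs; elim: t => [x|a l IHl r IHr] /=; first by rewrite cats0.
by rewrite map_cat flatten_cat; apply: labelled_node.
Qed.

Lemma labelled_graft (X Y : choiceType) (s : X -> seq Y) (q : X -> F Y) u p :
  p \in labelled_by u -> (forall x, q x \in labelled_by (s x)) ->
  graft q p \in labelled_by (flatten [seq s x | x <- u]).
Proof.
move=> /labelledP pu qs; apply: labelled_lift => t /pu tu.
rewrite -(perm_labelled (perm_flatten (perm_map s tu))).
exact: labelled_subst.
Qed.

Lemma labelled_relabel (X Y : choiceType) (f : X -> Y) s p :
  p \in labelled_by s -> relabel f p \in labelled_by (map f s).
Proof.
move=> ps; rewrite relabelE -[map f s]flatten_seq1 -map_comp.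
apply: labelled_graft => // x; exact: labelledU.
Qed.

End TreeModule.

(* -------------------------------------------------------------------------- *)
Section TreeOperad.
Variables (K : fieldType) (A : choiceType).

Local Notation F X := {malg K[tree A X]}.

Record tree_op (I : finType) : predArgType :=
  TreeOp { tree_val : F I; _ : tree_val \in @labelled_by K A I (enum I) }.

HB.instance Definition _ (I : finType) := [isSub for @tree_val I].
HB.instance Definition _ (I : finType) := [Choice of tree_op I by <:].
HB.instance Definition _ (I : finType) :=
  [SubChoice_isSubLmodule of tree_op I by <:].

Definition trop (I : finType) : lmodType K := tree_op I.

Lemma trop_labelled I (p : trop I) : tree_val p \in @labelled_by K A I (enum I).
Proof. exact: valP. Qed.

Lemma tree_valP (I : finType) c (p q : trop I) :
  tree_val (c *: p + q) = c *: tree_val p + tree_val q.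
Proof. exact: (linearP (val : trop I -> F I)). Qed.

Fact trop_act_subproof (I J : finType) (f : I -> J) (bf : bijective f) p :
  p \in @labelled_by K A I (enum I) ->
  relabel f p \in @labelled_by K A J (enum J).
Proof.
move/(labelled_relabel f).
have fE : perm_eq (map f (enum I)) (enum J).
  apply: uniq_perm; rewrite ?(map_inj_uniq (bij_inj bf)) ?enum_uniq //.
  move=> j; rewrite mem_enum; case: bf => g _ gK.
  by apply/mapP; exists (g j); rewrite ?mem_enum.
by rewrite (perm_labelled fE).
Qed.

Definition trop_act (I J : finType) (f : I -> J) (bf : bijective f)
    (p : trop I) : trop J :=
  TreeOp (trop_act_subproof bf (trop_labelled p)).

Fact trop_id_subproof :
  << Leaf (ord0 : 'I_1) >> \in @labelled_by K A 'I_1 (enum 'I_1).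
Proof. by apply: labelledU; rewrite enum_ordSl enum_ord0. Qed.

Definition trop_id : trop 'I_1 := TreeOp trop_id_subproof.

Fact trop_comp_subproof (I : finType) (J : I -> finType) p
    (q : forall i, F (J i)) :
  p \in @labelled_by K A I (enum I) ->
  (forall i, q i \in @labelled_by K A (J i) (enum (J i))) ->
  graft (fun i => relabel (existT J i) (q i)) p
    \in @labelled_by K A {i : I & J i} (enum {: {i : I & J i}}).
Proof.
move=> pI qJ; have sE : perm_eq
    (flatten [seq [seq existT J i j | j <- enum (J i)] | i <- enum I])
    (enum {: {i : I & J i}}).
  apply: uniq_perm; rewrite ?enum_uniq //.
    apply: allpairs_uniq_dep => [|i _|u v _ _ /= uv]; rewrite ?enum_uniq //.
    by case: u v uv => i x [j y].
  move=> [i j]; rewrite mem_enum; apply/allpairsPdep.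
  by exists i, j; rewrite !mem_enum.
rewrite -(perm_labelled sE); apply: labelled_graft => // i.
exact: labelled_relabel.
Qed.

Definition trop_comp (I : finType) (J : I -> finType) (p : trop I)
    (q : forall i, trop (J i)) : trop {i : I & J i} :=
  TreeOp (trop_comp_subproof (trop_labelled p) (fun i => trop_labelled (q i))).

Fact trop_act_linear I J f bf : linear (@trop_act I J f bf).
Proof.
move=> c p q; apply: val_inj; rewrite /=.
exact: relabel_linear.
Qed.

Fact trop_act_id (I : finType) (f : I -> I) (bf : bijective f) p :
  f =1 id -> trop_act bf p = p.
Proof.
move=> fid; apply: val_inj; rewrite /= relabelE -[RHS]graft_id.
by apply: eq_graft => i; rewrite fid.
Qed.

Lemma relabel_graft (X Y Z : choiceType) (f : Y -> Z) (q : X -> F Y) p :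
  relabel f (graft q p) = graft (fun x => relabel f (q x)) p.
Proof.
rewrite relabelE graft_graft; apply: eq_graft => x.
by rewrite relabelE.
Qed.

Lemma graft_relabel (X Y Z : choiceType) (f : X -> Y) (q : Y -> F Z) p :
  graft q (relabel f p) = graft (fun x => q (f x)) p.
Proof.
by rewrite relabelE graft_graft; apply: eq_graft => x; rewrite graftU.
Qed.

Lemma relabel_comp (X Y Z : choiceType) (f : X -> Y) (g : Y -> Z) (h : X -> Z)
    (p : F X) :
  h =1 g \o f -> relabel g (relabel f p) = relabel h p.
Proof.
move=> hgf; rewrite !relabelE graft_graft; apply: eq_graft => x.
by rewrite graftU /= hgf.
Qed.

Fact trop_act_comp (I J L : finType) (f : I -> J) (g : J -> L)
    (h : I -> L) (bf : bijective f) (bg : bijective g) (bh : bijective h) p :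
  h =1 g \o f -> trop_act bg (trop_act bf p) = trop_act bh p.
Proof. by move=> hgf; apply: val_inj; apply: relabel_comp. Qed.

Fact trop_comp_linear_l (I : finType) (J : I -> finType)
  (q : forall i, trop (J i)) : linear (fun p => trop_comp p q).
Proof.
move=> c x y; apply: val_inj; rewrite /=.
exact: graft_linear.
Qed.

Fact trop_comp_linear_r (I : finType) (J : I -> finType) (p : trop I)
    (q : forall i, trop (J i)) (i : I) :
  linear (fun x : trop (J i) => trop_comp p (dfwith q x)).
Proof.
move=> c x y; apply: val_inj; rewrite /=.
case: p => p /= /labelledP pI; rewrite /graft /free_lift scaler_sumr.
rewrite -big_split /= !big_seq; apply: eq_bigr => t /pI tI.
rewrite scalerA mulrC -scalerA -scalerDr; congr (_ *: _).
apply: (@subst_multilinear _ _ _ _ _ _ _ i).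
- by move=> j ji; rewrite !dfwith_out // eq_sym.
- by rewrite !dfwith_in tree_valP; apply: relabel_linear.
by move/seq.permP: tI => ->; rewrite (count_uniq_mem _ (enum_uniq _)) mem_enum.
Qed.

Fact trop_comp_act_l (I I' : finType) (J : I' -> finType) (f : I -> I')
    (bf : bijective f)
    (bh : bijective (fun u : {i : I & J (f i)} =>
                       existT J (f (projT1 u)) (projT2 u)))
    (p : trop I) (q : forall i, trop (J i)) :
  trop_comp (trop_act bf p) q = trop_act bh (trop_comp p (fun i => q (f i))).
Proof.
apply: val_inj; rewrite /= graft_relabel relabel_graft; apply: eq_graft => i.
by apply/esym/relabel_comp.
Qed.

Fact trop_comp_act_r (I : finType) (J J' : I -> finType)
    (g : forall i, J i -> J' i) (bg : forall i, bijective (g i))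
    (bh : bijective (fun u : {i : I & J i} =>
                       existT J' (projT1 u) (g (projT1 u) (projT2 u))))
    (p : trop I) (q : forall i, trop (J i)) :
  trop_comp p (fun i => trop_act (bg i) (q i)) = trop_act bh (trop_comp p q).
Proof.
apply: val_inj; rewrite /= relabel_graft; apply: eq_graft => i.
by rewrite (@relabel_comp _ _ _ _ _ (fun j => existT J' i (g i j))) // 
  (@relabel_comp _ _ _ _ _ (fun j => existT J' i (g i j))).
Qed.

Fact trop_comp_id_l (I : finType)
    (bf : bijective (fun u : {_ : 'I_1 & I} => projT2 u)) (p : trop I) :
  trop_act bf (trop_comp trop_id (fun _ => p)) = p.
Proof.
apply: val_inj; rewrite /= relabel_graft graftU /=.
rewrite (@relabel_comp _ _ _ _ _ id) // relabelE; exact: graft_id.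
Qed.

Fact trop_comp_id_r (I : finType)
    (bf : bijective (fun u : {_ : I & 'I_1} => projT1 u)) (p : trop I) :
  trop_act bf (trop_comp p (fun _ => trop_id)) = p.
Proof.
apply: val_inj; rewrite /= relabel_graft -[RHS]graft_id.
by apply: eq_graft => i; rewrite !relabelE graftU /= ?graftU.
Qed.

Fact trop_comp_assoc (I : finType) (J : I -> finType)
    (L : forall i, J i -> finType)
    (bh : bijective (fun w : {u : {i : I & J i} & L (projT1 u) (projT2 u)} =>
       existT (fun i => {j : J i & L i j}) (projT1 (projT1 w))
         (existT (L (projT1 (projT1 w))) (projT2 (projT1 w)) (projT2 w))))
    (p : trop I) (q : forall i, trop (J i))
    (r : forall i (j : J i), trop (L i j)) :
  trop_act bh (trop_comp (trop_comp p q) (fun u => r (projT1 u) (projT2 u)))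
    = trop_comp p (fun i => trop_comp (q i) (r i)).
Proof.
apply: val_inj; rewrite /= relabel_graft graft_graft; apply: eq_graft => i.
rewrite graft_relabel relabel_graft; apply: eq_graft => j /=.
by rewrite (@relabel_comp _ _ _ _ _
     (fun l => existT (fun i => {j : J i & L i j}) i (existT (L i) j l))) //
   (@relabel_comp _ _ _ _ _
     (fun l => existT (fun i => {j : J i & L i j}) i (existT (L i) j l))).
Qed.

(* The free symmetric operad on a family, indexed by A, of binary operations   *)
(* without symmetry: the operation Node a (Leaf 0) (Leaf 1) is the generator   *)
(* attached to a.                                                              *)
Definition tree_operad : operad K :=
  Operad trop_act_linear trop_act_id trop_act_comp trop_comp_linear_l
    trop_comp_linear_r trop_comp_act_l trop_comp_act_r trop_comp_id_l
    trop_comp_id_r trop_comp_assoc.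

Fact tree_gen_subproof (a : A) :
  << Node a (Leaf (ord0 : 'I_2)) (Leaf ord_max) >>
    \in @labelled_by K A 'I_2 (enum 'I_2).
Proof.
apply: labelledU; rewrite enum_ordSl enum_ordSl enum_ord0 /=.
by have -> : lift ord0 ord0 = ord_max :> 'I_2 by apply: val_inj.
Qed.

Definition tree_gen (a : A) : tree_operad 'I_2 := TreeOp (tree_gen_subproof a).

End TreeOperad.

(* -------------------------------------------------------------------------- *)
Section PreLiePhi.
Variables (K : fieldType) (A : lmodType K).
Variable Phi : {linear tensor A A -> tensor A A}.

Local Notation T := (tree_operad K A).
Local Notation g := (@tree_gen K A).

(* The relations between the generators g a = o_a. The Sweedler sum            *)
(* Phi(a (x) b) = sum (a' -> b') (x) (a'' |> b'') is written as the sum of     *)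
(* c (x) d for (c, d) in s; every decomposition s is allowed, which does not   *)
(* matter because of the linearity relations.                                  *)
Definition tensor_of (s : seq (A * A)) : tensor A A :=
  \sum_(cd <- s) tens cd.1 cd.2.

Inductive prelie_relation : forall I : finType, T I -> Prop :=
| prelie_relation_linear (k : K) (a b : A) :
    @prelie_relation 'I_2 (g (k *: a + b) - k *: g a - g b)
| prelie_relation_quadratic (a b : A) (s t : seq (A * A)) :
    Phi (tens a b) = tensor_of s -> Phi (tens b a) = tensor_of t ->
    @prelie_relation 'I_3
      ((op_comp_id_op (g a) (g b)
          - \sum_(cd <- s) op_comp_op_id (g cd.1) (g cd.2))
       - op_act12 (op_comp_id_op (g b) (g a)
          - \sum_(cd <- t) op_comp_op_id (g cd.1) (g cd.2))).

(* The operad presented by the generators o_a, a in A, and these relations.    *)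
Definition PreLie : operad K := quot_operad prelie_relation.

Definition circ (a : A) : PreLie 'I_2 := qop_pi prelie_relation (g a).

Lemma circ_linear : linear circ.
Proof.
move=> k a b; rewrite /circ -(qop_pi_linear prelie_relation k (g a) (g b)).
apply/qpiP; rewrite opprD addrA; apply: ideal_gen.
exact: prelie_relation_linear.
Qed.

Lemma circ_prelie a b s t :
  Phi (tens a b) = tensor_of s -> Phi (tens b a) = tensor_of t ->
  op_comp_id_op (circ a) (circ b)
      - \sum_(cd <- s) op_comp_op_id (circ cd.1) (circ cd.2)
    = op_act12 (op_comp_id_op (circ b) (circ a)
      - \sum_(cd <- t) op_comp_op_id (circ cd.1) (circ cd.2)).
Proof.
move=> sE tE; have piE x y u : op_comp_id_op (circ x) (circ y)
    - \sum_(cd <- u) op_comp_op_id (circ cd.1) (circ cd.2)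
  = qop_pi prelie_relation (op_comp_id_op (g x) (g y)
      - \sum_(cd <- u) op_comp_op_id (g cd.1) (g cd.2)).
  rewrite /qop_pi [RHS]linearB; congr (_ + - _).
    exact: (@qop_comp2_pi _ _ prelie_relation 1 2).
  rewrite [RHS]linear_sum; apply: eq_bigr => cd _.
  exact: (@qop_comp2_pi _ _ prelie_relation 2 1).
rewrite !piE /op_act12 /= (qop_act_pi _ swap12_bij).
by apply/qpiP/ideal_gen/prelie_relation_quadratic.
Qed.

End PreLiePhi.

Arguments circ {K A} Phi a.

(* Main.v *)
Require Import Defs.
From HB Require Import structures.
From mathcomp Require Import all_boot all_order all_algebra.
From mathcomp Require Import finmap perm boolp monalg.
From mathcomp Require classical_sets.

Set Implicit Arguments.
Unset Strict Implicit.
Unset Printing Implicit Defensive.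

Import GRing.Theory.
Local Open Scope ring_scope.

(* A binary operation has the form x o_a y + y o_b x. Its composites of arity *)
(* 3 are told apart by evaluating them in a Phi-prelie algebra, graded and     *)
(* truncated after degree 3. One choice of its structure maps makes it         *)
(* Phi-associative: u o_a (v o_b w) is the sum of the (u o_d v) o_c w for      *)
(* Phi(a (x) b) = sum c (x) d. Another one kills (u o_d v) o_c w and makes     *)
(* u o_a (v o_b w) symmetric under (a, u) <-> (b, v). In both cases of the     *)
(* theorem this gives b (x) b = 0, hence b = 0, and the value of Phi(a (x) a). *)

(** If [a] is special of eigenvalue 1 or 0, the defining relation for the pair (a, a), with the
    decomposition [[:: (a, a)]] or [[::]], is the prelie or NAP identity of [circ Phi a].
    Conversely, [binopP] writes a binary operation as x o_a y + y o_b x, and an identity it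
    satisfies must hold in every Phi-prelie algebra ([op_ideal_eval], [eval3_eq]). [model_prelie]
    provides such algebras, used with degree 3 part A (x) A; evaluating at three letters turns the
    identity into equations between tensors ([NAP_binop_model], [prelie_binop_model]). They force b
    (x) b = 0, so b = 0 by [tens_diag_eq0], and then Phi(a (x) a) is 0 or a (x) a. *)

Lemma linear_map0 (K : fieldType) (U V : lmodType K) (f : U -> V) :
  linear f -> f 0 = 0.
Proof.
by move=> fl; have := fl (-1) 0 0; rewrite scaler0 addr0 scaleN1r addNr.
Qed.

(** * Elementary rules for bilinear maps *)

Section Bilin.
Variables (K : fieldType) (U V W : lmodType K).
Variables (f : U -> V -> W) (fB : bilin f).

Lemma bilin0l v : f 0 v = 0.
Proof. exact: linear_map0 (fB.1 v). Qed.

Lemma bilin0r u : f u 0 = 0.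
Proof. exact: linear_map0 (fB.2 u). Qed.

Lemma bilinZr c u v : f u (c *: v) = c *: f u v.
Proof. by have := fB.2 u c v 0; rewrite bilin0r !addr0. Qed.

Lemma bilinDl u u' v : f (u + u') v = f u v + f u' v.
Proof. by have := fB.1 v 1 u u'; rewrite !scale1r. Qed.

Lemma bilinDr u v v' : f u (v + v') = f u v + f u v'.
Proof. by have := fB.2 u 1 v v'; rewrite !scale1r. Qed.

End Bilin.

(** * Linear functionals and squares b (x) b *)

Section Functional.
Variables (K : fieldType) (U : lmodType K).

Lemma span_sub (R S : U -> Prop) : (forall u, R u -> S u) ->
  forall u, in_span R u -> in_span S u.
Proof.
move=> RS u; elim=> {u} [u /RS|| c u v _ Su _ Sv].
- exact: span_gen.
- exact: span_0.
exact: span_lin.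
Qed.

(** The coefficient c collects the multiples of w in the combination. *)
Lemma span_addP (R : U -> Prop) w u :
  in_span (fun x => R x \/ x = w) u -> exists c, in_span R (u - c *: w).
Proof.
elim=> {u} [u [Ru|->]|| k u v _ [c Hu] _ [d Hv]].
- by exists 0; rewrite scale0r subr0; apply: span_gen.
- by exists 1; rewrite scale1r subrr; apply: span_0.
- by exists 0; rewrite scale0r subr0; apply: span_0.
exists (k * c + d); rewrite scalerDl opprD addrACA -scalerA -scalerBr.
exact: span_lin.
Qed.

(** A linear combination uses finitely many sets of a chain, hence lives in the largest of them; the
    case u = 0 covers the empty chain. *)
Lemma span_directed (F : (U -> Prop) -> Prop) :
  (forall X Y, F X -> F Y ->
     (forall u, X u -> Y u) \/ (forall u, Y u -> X u)) ->
  forall u, in_span (fun v => exists2 X, F X & X v) u ->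
  u = 0 \/ exists2 X, F X & in_span X u.
Proof.
move=> Fdir u; elim=> {u} [u [X FX Xu]|| c u v _ IHu _ IHv].
- by right; exists X => //; apply: span_gen.
- by left.
case: IHu IHv => [->|[X FX Xu]] [->|[Y FY Yv]].
- by left; rewrite scaler0 addr0.
- by right; exists Y => //; rewrite scaler0 add0r.
- by right; exists X => //; apply: span_lin => //; apply: span_0.
have [XY|YX] := Fdir _ _ FX FY; right.
  by exists Y => //; apply: span_lin => //; apply: span_sub Xu.
by exists X => //; apply: span_lin => //; apply: span_sub Yv.
Qed.

(* The span of a maximal set whose span avoids b is a complement of the line  *)
(* generated by b.                                                            *)
Lemma exists_functional (b : U) : b != 0 ->
  exists2 f : U -> K^o, linear f & f b = 1.
Proof.
move=> b0; have spanZ (R : U -> Prop) c u : in_span R u -> in_span R (c *: u).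
  by move=> Ru; rewrite -[c *: u]addr0; apply: span_lin => //; apply: span_0.
have [|X [Xb Xmax]] := @classical_sets.Zorn_bigcup U (fun X => ~ in_span X b).
  move=> F FP Ftot /(span_directed (F := F)) [X Y FX FY||[X FX]].
  - exact: Ftot.
  - exact/eqP.
  exact: FP.
have ex v : exists c, in_span X (v - c *: b).
  have [Xv|nXv] := pselect (in_span X v).
    by exists 0; rewrite scale0r subr0.
  (* By maximality, adding v to X brings b into the span; the relation is then solved for v. *)
  have /contrapT : ~ ~ in_span (fun x => X x \/ x = v) b.
    apply: Xmax; split=> [u|sub]; first by left.
    by apply: nXv; apply: span_gen; apply: sub; right.
  move=> /span_addP [c Xc].
  have c0 : c != 0.
    by apply/eqP => c0; apply: Xb; move: Xc; rewrite c0 scale0r subr0.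
  exists c^-1; move/(spanZ _ (- c^-1)): Xc.
  by rewrite scalerBr !scaleNr opprK scalerA mulVf // scale1r addrC.
have [f fP] := choice ex.
(* Two distinct coefficients would put a nonzero multiple of b in the span of X. This uniqueness
   makes [f] linear. *)
have uniq v c : in_span X (v - c *: b) -> f v = c.
  move=> Xc; apply/eqP/negPn/negP; rewrite -subr_eq0 => fc; apply: Xb.
  have := span_lin (-1) (fP v) Xc => /(spanZ _ (f v - c)^-1).
  rewrite scaleN1r opprB addrA subrK -scalerBl scalerA mulVf //.
  by rewrite scale1r.
exists f; last by apply: uniq; rewrite scale1r subrr; apply: span_0.
move=> c u v; apply: uniq.
rewrite scalerDl opprD addrACA -[(c *: (f u : K^o)) *: b]scalerA -scalerBr.
exact: span_lin.
Qed.

(** If f b = 1, the map f (x) f sends b (x) b to 1. *)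
Lemma tens_diag_eq0 (b : U) : tens b b = 0 -> b = 0.
Proof.
move=> bb; apply/eqP/negPn/negP => /exists_functional [f flin fb].
have fB : bilin (fun u v => f u * f v : K^o).
  split=> [v c x y|u c x y]; first by rewrite flin mulrDl -scalerAl.
  by rewrite flin mulrDr -scalerAr.
have := tlift_tens b b fB; rewrite bb fb mulr1.
rewrite (linear_map0 (tlift_linear fB)).
by move/esym/eqP; rewrite oner_eq0.
Qed.

End Functional.

(** * Evaluation of operations in an algebra *)

Section Evaluation.
Variables (K : fieldType) (A V : lmodType K) (m : A -> V -> V -> V).

Fixpoint tree_eval (X : Type) (v : X -> V) (t : tree A X) : V :=
  match t with
  | Leaf x => v x
  | Node a l r => m a (tree_eval v l) (tree_eval v r)
  end.

(** For bilinear [m], this is the operad morphism to the endomorphism operad of V, applied to the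
    arguments [v]. *)
Definition op_eval (I : finType) (v : I -> V) (p : tree_operad K A I) : V :=
  free_lift (tree_eval v) (tree_val p).

Lemma op_eval_linear I v : linear (@op_eval I v).
Proof. by move=> c p q; rewrite /op_eval tree_valP linearP. Qed.

HB.instance Definition _ I v :=
  GRing.isLinear.Build K (tree_operad K A I) V *:%R (@op_eval I v)
    (op_eval_linear v).

Lemma eq_op_eval (I : finType) (v w : I -> V) p : v =1 w ->
  op_eval v p = op_eval w p.
Proof. by move=> /funext ->. Qed.

Lemma op_eval_gen v a :
  op_eval v (tree_gen K a) = m a (v ord0) (v ord_max).
Proof. exact: free_liftU. Qed.

Lemma op_eval_id v : op_eval v op_id = v ord0.
Proof. exact: free_liftU. Qed.

Lemma op_eval_act (I J : finType) (f : I -> J) (bf : bijective f) v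
    (p : tree_operad K A I) :
  op_eval v (op_act bf p) = op_eval (v \o f) p.
Proof.
rewrite /op_eval /= /relabel linear_free_lift; apply: eq_free_lift => t _ /=.
by rewrite free_liftU; elim: t => //= a s -> t ->.
Qed.

Hypothesis mB : forall a, bilin (m a).

Let m0l a y : m a 0 y = 0.
Proof. exact: bilin0l. Qed.

Let m0r a x : m a x 0 = 0.
Proof. exact: bilin0r. Qed.

Lemma eval_node (X : choiceType) (v : X -> V) a (p q : {malg K[tree A X]}) :
  free_lift (tree_eval v) (node a p q)
    = m a (free_lift (tree_eval v) p) (free_lift (tree_eval v) q).
Proof.
elim/malg_ind: p => [|c s p IHp]; first by rewrite node0l !linear0 m0l.
rewrite (nodePl a c << s >> p).
rewrite (free_lift_is_linear (tree_eval v) c << s >> p) (mB a).1 -IHp.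
rewrite (free_lift_is_linear (tree_eval v) c (node a << s >> q)).
congr (_ *: _ + _); move: {IHp p} q; elim/malg_ind => [|d t q IHq].
  by rewrite node0r !linear0 m0r.
rewrite (nodePr a d << s >> << t >> q) nodeU.
rewrite (free_lift_is_linear (tree_eval v) d << t >> q) (mB a).2 -IHq.
rewrite (free_lift_is_linear (tree_eval v) d << Node a s t >>).
congr (_ *: _ + _); apply: (etrans (free_liftU _ _)) => /=.
by congr (m a _ _); apply/esym/free_liftU.
Qed.

Lemma op_eval_comp (I : finType) (J : I -> finType) v (p : tree_operad K A I)
    (q : forall i, tree_operad K A (J i)) :
  op_eval v (op_comp p q)
    = op_eval (fun i => op_eval (fun j => v (existT _ i j)) (q i)) p.
Proof.
rewrite /op_eval /= /graft linear_free_lift; apply: eq_free_lift => t _ /=.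
elim: t => [i|a s IHs t IHt] /=; last by rewrite eval_node IHs IHt.
rewrite /relabel linear_free_lift; apply: eq_free_lift => t _ /=.
by rewrite free_liftU; elim: t => //= a s -> t ->.
Qed.

Lemma tree_eval_eq0 (X : eqType) (v : X -> V) t x :
  x \in leaves t -> v x = 0 -> tree_eval v t = 0.
Proof.
move=> xt vx; elim: t xt => [y|a s IHs t IHt] /=.
  by rewrite inE => /eqP <-.
by rewrite mem_cat => /orP[/IHs ->|/IHt ->]; rewrite ?m0l ?m0r.
Qed.

(** Every input labels a leaf of every tree in the support, and the bilinear products propagate a
    zero up to the root. *)
Lemma op_eval_eq0 I v (p : tree_operad K A I) i : v i = 0 -> op_eval v p = 0.
Proof.
move=> vi; rewrite /op_eval /free_lift big_seq big1 // => t tp.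
rewrite (@tree_eval_eq0 _ _ _ i) ?scaler0 //.
by have /labelledP/(_ t tp)/perm_mem -> := trop_labelled p; rewrite mem_enum.
Qed.

Lemma op_eval_comp2 k n v p q r :
  op_eval v (@op_comp2 _ (tree_operad K A) k n p q r)
    = op_eval (pair_fam (op_eval (v \o @lshift k n) q)
                        (op_eval (v \o @rshift k n) r)) p.
Proof.
rewrite /op_comp2 op_eval_act op_eval_comp; apply: eq_op_eval => i.
case: i => -[|[|//]] lti; rewrite /pair_op /pair_fam /=; apply: eq_op_eval => j;
  by rewrite /flat2.
Qed.

Definition op_eval2 (p : tree_operad K A 'I_2) (x y : V) : V :=
  op_eval (pair_fam x y) p.

Lemma op_eval2E v p : op_eval v p = op_eval2 p (v ord0) (v ord_max).
Proof.
by apply: eq_op_eval => -[[|[|//]] lti]; congr v; apply: val_inj.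
Qed.

Lemma op_eval2_gen a x y : op_eval2 (tree_gen K a) x y = m a x y.
Proof. exact: op_eval_gen. Qed.

Definition eval3 (p : tree_operad K A 'I_3) (x y z : V) : V :=
  op_eval (tnth [tuple x; y; z]) p.

Lemma eval3_id_op p q x y z :
  eval3 (op_comp_id_op p q) x y z = op_eval2 p x (op_eval2 q y z).
Proof.
apply: (etrans (@op_eval_comp2 1 2 _ _ _ _)).
rewrite op_eval2E /pair_fam /= op_eval_id op_eval2E /=.
by rewrite !(tnth_nth x).
Qed.

Lemma eval3_op_id p q x y z :
  eval3 (op_comp_op_id p q) x y z = op_eval2 p (op_eval2 q x y) z.
Proof.
apply: (etrans (@op_eval_comp2 2 1 _ _ _ _)).
rewrite op_eval2E /pair_fam /= op_eval_id op_eval2E /=.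
by rewrite !(tnth_nth x).
Qed.

Lemma eval3_act12 p x y z : eval3 (op_act12 p) x y z = eval3 p y x z.
Proof.
rewrite /eval3 /op_act12 op_eval_act; apply: eq_op_eval => i.
rewrite /= /swap12.
have -> : inord 0 = ord0 :> 'I_3 by apply: val_inj; rewrite /= inordK.
have -> : inord 1 = lift ord0 ord0 :> 'I_3 by apply: val_inj; rewrite /= inordK.
case: i => -[|[|[|//]]] lti.
- by rewrite (_ : Ordinal _ = ord0) ?tpermL //; apply: val_inj.
- by rewrite (_ : Ordinal _ = lift ord0 ord0) ?tpermR //; apply: val_inj.
by rewrite tpermD.
Qed.

(** All decompositions of Phi(a (x) b) are allowed, to match the generators in [prelie_relation]. *)
Definition prelie_algebra (Phi : {linear tensor A A -> tensor A A}) : Prop :=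
  (forall x y, linear (fun a => m a x y)) /\
  forall a b s t x y z,
    Phi (tens a b) = tensor_of s -> Phi (tens b a) = tensor_of t ->
    m a x (m b y z) - \sum_(cd <- s) m cd.1 (m cd.2 x y) z
      = m b y (m a x z) - \sum_(cd <- t) m cd.1 (m cd.2 y x) z.

Lemma eval3_relation a b (s : seq (A * A)) x y z :
  eval3 (op_comp_id_op (tree_gen K a) (tree_gen K b)
    - \sum_(cd <- s) op_comp_op_id (tree_gen K cd.1) (tree_gen K cd.2)) x y z
  = m a x (m b y z) - \sum_(cd <- s) m cd.1 (m cd.2 x y) z.
Proof.
rewrite /eval3 linearB; congr (_ - _).
  by apply: (etrans (eval3_id_op _ _ _ _ _)); rewrite !op_eval2_gen.
apply: (etrans (linear_sum (op_eval _) _ _ _)); apply: eq_bigr => cd _.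
by apply: (etrans (eval3_op_id _ _ _ _ _)); rewrite !op_eval2_gen.
Qed.

(** The axioms of the algebra kill the generators of the ideal, and each closure rule preserves
    vanishing; an ideal element plugged into an input puts a zero there, whence [op_eval_eq0]. *)
Lemma op_ideal_eval Phi (I : finType) (p : tree_operad K A I) v :
  prelie_algebra Phi -> op_ideal (@prelie_relation K A Phi) p ->
  op_eval v p = 0.
Proof.
move=> [mlin mprelie] Hp; elim: Hp v => {I p}.
- move=> I p [k a b|a b s t sE tE] v.
    by rewrite !linearB linearZ /= !op_eval_gen mlin -addrA -opprD subrr.
  have -> : v = tnth [tuple v ord0; v (lift ord0 ord0); v ord_max].
    by apply/funext => -[[|[|[|//]]] lti]; rewrite (tnth_nth (v ord0)) /=;
       congr v; apply: val_inj.
  rewrite linearB; apply/eqP; rewrite subr_eq0; apply/eqP.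
  apply: (etrans (eval3_relation _ _ _ _ _ _)).
  apply: (etrans _ (esym (eval3_act12 _ _ _ _))).
  by rewrite eval3_relation; apply: mprelie.
- by move=> I v; rewrite linear0.
- by move=> I c p q _ IHp _ IHq v; rewrite op_eval_linear IHp IHq scaler0 addr0.
- by move=> I J f bf p _ IH v; rewrite op_eval_act IH.
- by move=> I J p q _ IH v; rewrite op_eval_comp IH.
- by move=> I J p q i _ IH v; rewrite op_eval_comp (@op_eval_eq0 _ _ _ i) ?IH.
Qed.

End Evaluation.

(** * Binary operations of [PreLie Phi] *)

Section Binary.
Variables (K : fieldType) (A : lmodType K).
Variable Phi : {linear tensor A A -> tensor A A}.

Lemma rev_ord_bij n : bijective (@rev_ord n).
Proof. by exists (@rev_ord n); apply: rev_ordK. Qed.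

(** On ['I_2], [rev_ord] exchanges the two inputs. *)
Definition tree_binop (a b : A) : tree_operad K A 'I_2 :=
  tree_gen K a + op_act (rev_ord_bij 2) (tree_gen K b).

Definition binop (a b : A) : PreLie Phi 'I_2 :=
  circ Phi a + op_act (rev_ord_bij 2) (circ Phi b).

Lemma binop_pi a b :
  binop a b = qop_pi (prelie_relation Phi) (tree_binop a b).
Proof. by rewrite /binop /= (qop_act_pi _ (rev_ord_bij 2)) /qop_pi -qpiD. Qed.

Lemma binop_linear c a b a' b' :
  binop (c *: a + a') (c *: b + b') = c *: binop a b + binop a' b'.
Proof.
by rewrite /binop !circ_linear op_act_linear scalerDr addrACA.
Qed.

Lemma circ0 : circ Phi 0 = 0.
Proof. exact: linear_map0 (circ_linear Phi). Qed.

Lemma binop0 a : binop a 0 = circ Phi a.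
Proof.
rewrite /binop circ0 (linear_map0 (op_act_linear (rev_ord_bij 2))).
by rewrite addr0.
Qed.

Lemma leaves_neq0 (X : Type) (t : tree A X) : (0 < size (leaves t))%N.
Proof. by elim: t => //= a s IHs t _; rewrite size_cat addn_gt0 IHs. Qed.

(** A second internal node would give at least three leaves; the two labels are distinct and come in
    either order. *)
Lemma binary_tree (t : tree A 'I_2) : perm_eq (leaves t) (enum 'I_2) ->
  exists a, << t >> = tree_val (tree_gen K a)
    \/ << t >> = tree_val (op_act (rev_ord_bij 2) (tree_gen K a)).
Proof.
move=> tI; have := perm_size tI; rewrite size_enum_ord.
case: t tI => // a; case=> [i|b s t] r; last first.
  move=> _ /=; rewrite !size_cat.
  by case: (size (leaves s)) (leaves_neq0 s) => // n _;
     case: (size (leaves t)) (leaves_neq0 t) => // k _;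
     case: (size (leaves r)) (leaves_neq0 r) => // l _; rewrite !addnS.
case: r => [j|b s t]; last first.
  move=> _ /=; rewrite !size_cat.
  by case: (size (leaves s)) (leaves_neq0 s) => // n _;
     case: (size (leaves t)) (leaves_neq0 t) => // k _; rewrite !addnS.
move=> /perm_uniq /=; rewrite enum_uniq inE andbT => ij _; exists a.
case: i j ij => -[|[|//]] i [[|[|//]] j] //= _; [left|right].
  by congr << Node a (Leaf _) (Leaf _) >>; apply: val_inj.
rewrite /= /relabel free_liftU /=.
by congr << Node a (Leaf _) (Leaf _) >>; apply: val_inj.
Qed.

(** The default 0 is never taken for a tree in the support of an operation, see [tree_monoE]. *)
Definition tree_mono (I : finType) (t : tree A I) : tree_operad K A I :=
  insubd (0 : tree_op K A I) << t >>.

Lemma tree_monoE (I : finType) (p : tree_operad K A I) t :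
  t \in msupp (tree_val p) -> tree_val (tree_mono t) = << t >>.
Proof.
move=> tp; apply: (insubdK (0 : tree_op K A I)); apply: labelledU.
exact: (labelledP _ _ (trop_labelled p)).
Qed.

Lemma tree_val_sum (I : finType) (T : Type) (s : seq T) (c : T -> K)
    (p : T -> tree_operad K A I) :
  tree_val (\sum_(t <- s) c t *: p t) = \sum_(t <- s) c t *: tree_val (p t).
Proof.
by elim: s => [|t s IHs]; rewrite ?big_nil // !big_cons tree_valP IHs.
Qed.

Lemma tree_op_sum (I : finType) (p : tree_operad K A I) :
  p = \sum_(t <- msupp (tree_val p)) (tree_val p)@_t *: tree_mono t.
Proof.
apply: val_inj; rewrite [RHS]tree_val_sum [LHS]malg_sum.
rewrite [LHS]big_seq [RHS]big_seq; apply: eq_bigr => t tp.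
by rewrite (tree_monoE tp).
Qed.

(** Operations of this form are stable under linear combinations, as o_a is linear in a, and each
    tree in the support of a representative gives one with a or b zero. *)
Lemma binopP (p : PreLie Phi 'I_2) : exists a b, p = binop a b.
Proof.
rewrite -(qop_piK p) [qrepr p]tree_op_sum; move: (qrepr p) => {}p.
pose Q (x : PreLie Phi 'I_2) := exists a b, x = binop a b.
have QP c x y : Q x -> Q y -> Q (c *: x + y).
  move=> [a [b ->]] [a' [b' ->]].
  by exists (c *: a + a'), (c *: b + b'); rewrite binop_linear.
have Q0 : Q 0.
  by exists 0, 0; rewrite binop0 circ0.
suff QU t : t \in msupp (tree_val p) -> Q (qop_pi _ (tree_mono t)).
  rewrite big_seq; apply: (big_rec (fun x => Q (qop_pi _ x))) => [|t x tp Qx].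
    by rewrite /qop_pi qpi0.
  by rewrite qop_pi_linear; apply: QP => //; apply: QU.
move=> tp; have [a tE] := binary_tree (labelledP _ _ (trop_labelled p) t tp).
case: tE => tE.
  exists a, 0; rewrite binop0; congr (qop_pi _ _); apply: val_inj.
  by rewrite [LHS](tree_monoE tp).
exists 0, a; have -> : tree_mono t = op_act (rev_ord_bij 2) (tree_gen K a).
  by apply: val_inj; rewrite [LHS](tree_monoE tp).
by rewrite /binop circ0 add0r /= (qop_act_pi _ (rev_ord_bij 2)).
Qed.

Lemma pi_comp_id_op (p q : tree_operad K A 'I_2) :
  op_comp_id_op (qop_pi (prelie_relation Phi) p : PreLie Phi _)
    (qop_pi (prelie_relation Phi) q)
  = qop_pi (prelie_relation Phi) (op_comp_id_op p q).
Proof. exact: (@qop_comp2_pi _ _ (prelie_relation Phi) 1 2). Qed.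

Lemma pi_comp_op_id (p q : tree_operad K A 'I_2) :
  op_comp_op_id (qop_pi (prelie_relation Phi) p : PreLie Phi _)
    (qop_pi (prelie_relation Phi) q)
  = qop_pi (prelie_relation Phi) (op_comp_op_id p q).
Proof. exact: (@qop_comp2_pi _ _ (prelie_relation Phi) 2 1). Qed.

Lemma pi_act12 (p : tree_operad K A 'I_3) :
  op_act12 (qop_pi (prelie_relation Phi) p : PreLie Phi _)
  = qop_pi (prelie_relation Phi) (op_act12 p).
Proof. exact: (qop_act_pi _ swap12_bij). Qed.

Lemma pi_sub (p q : tree_operad K A 'I_3) :
  qop_pi (prelie_relation Phi) (p - q)
  = qop_pi (prelie_relation Phi) p - qop_pi (prelie_relation Phi) q.
Proof. exact: (linearB (qpi _)). Qed.

Section Evaluation.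
Variables (V : lmodType K) (m : A -> V -> V -> V).
Hypotheses (mB : forall a, bilin (m a)) (mP : prelie_algebra m Phi).

Let P a b x y := m a x y + m b y x.

Lemma op_eval2_binop a b x y :
  op_eval2 m (tree_binop a b) x y = m a x y + m b y x.
Proof.
apply: (etrans (linearD (op_eval m _) _ _)); congr (_ + _).
  exact: op_eval_gen.
by apply: (etrans (op_eval_act _ _ _ _)); apply: op_eval_gen.
Qed.

Lemma eval3_eq (p q : tree_operad K A 'I_3) x y z :
  qop_pi (prelie_relation Phi) p = qop_pi (prelie_relation Phi) q ->
  eval3 m p x y z = eval3 m q x y z.
Proof.
move=> /qpiP /(op_ideal_eval mB (tnth [tuple x; y; z]) mP).
by rewrite linearB => /eqP; rewrite subr_eq0 => /eqP.
Qed.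

Lemma eval3B (p q : tree_operad K A 'I_3) x y z :
  eval3 m (p - q) x y z = eval3 m p x y z - eval3 m q x y z.
Proof. exact: (linearB (op_eval _ _)). Qed.

Lemma prelie_binop_eval a b x y z : prelie_product (binop a b) ->
  P a b x (P a b y z) - P a b (P a b x y) z
    = P a b y (P a b x z) - P a b (P a b y x) z.
Proof.
rewrite binop_pi /prelie_product !pi_comp_id_op !pi_comp_op_id !pi_act12.
rewrite -!pi_sub => /(eval3_eq x y z); rewrite !eval3B !(eval3_act12 m).
by rewrite !(eval3_id_op mB) !(eval3_op_id mB) !op_eval2_binop.
Qed.

Lemma NAP_binop_eval a b x y z : NAP_product (binop a b) ->
  P a b x (P a b y z) = P a b y (P a b x z).
Proof.
rewrite binop_pi /NAP_product pi_comp_id_op pi_act12 => /(eval3_eq x y z).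
by rewrite (eval3_act12 m) !(eval3_id_op mB) !op_eval2_binop.
Qed.

End Evaluation.
End Binary.

(** * A graded algebra truncated after degree 3 *)

Section Model.
Variables (K : fieldType) (A W : lmodType K) (l r s : A -> A -> W).
Hypotheses (lB : bilin l) (rB : bilin r) (sB : bilin s).

(* Degree 1 has basis the letters 0, 1, 2; the words 01, 12, 02, with          *)
(* coefficients in A, span degree 2; l, r and s give the products              *)
(* (0 1) 2, 0 (1 2) and 1 (0 2) in degree 3, all other products vanish.        *)
Definition model : lmodType K :=
  ((K^o * K^o * K^o) * (A * A * A) * W)%type.

Definition letter0 : model := (((1, 0), 0), 0, 0).
Definition letter1 : model := (((0, 1), 0), 0, 0).
Definition letter2 : model := (((0, 0), 1), 0, 0).

Definition model_mul (a : A) (u v : model) : model :=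
  let: ((u0, u1, u2), (u01, u12, u02), _) := u in
  let: ((v0, v1, v2), (v01, v12, v02), _) := v in
  (0, ((u0 * v1) *: a, (u1 * v2) *: a, (u0 * v2) *: a),
   v2 *: l a u01 + u0 *: r a v12 + u1 *: s a v02).

Let scaleP c (d e : K^o) (X : lmodType K) (x : X) :
  (c *: d + e) *: x = c *: (d *: x) + e *: x.
Proof. by rewrite scalerDl; congr (_ + _); rewrite scalerA. Qed.

Let scaleC (c d : K) (X : lmodType K) (x : X) :
  c *: (d *: x) = d *: (c *: x).
Proof. by rewrite !scalerA mulrC. Qed.

Let scale_mulPl c (d e f : K^o) (X : lmodType K) (x : X) :
  ((c *: d + e) * f) *: x = c *: ((d * f) *: x) + (e * f) *: x.
Proof. by rewrite -scalerA scaleP -!scalerA. Qed.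

Let scale_mulPr c (d e f : K^o) (X : lmodType K) (x : X) :
  (f * (c *: d + e)) *: x = c *: ((f * d) *: x) + (f * e) *: x.
Proof. by rewrite ![f * _]mulrC scale_mulPl. Qed.

Lemma model_mul_bilin a : bilin (model_mul a).
Proof.
split.
  move=> [[[[v0 v1] v2] [[v01 v12] v02]] vt] c
    [[[[u0 u1] u2] [[u01 u12] u02]] ut] [[[[w0 w1] w2] [[w01 w12] w02]] wt].
  congr (_, (_, _, _), _) => /=; rewrite ?scale_mulPl ?scaler0 ?addr0 //.
  rewrite lB.2 !scaleP !scalerDr [v2 *: (c *: _)]scaleC.
  by rewrite [RHS]addrACA; congr (_ + _); rewrite [RHS]addrACA.
move=> [[[[v0 v1] v2] [[v01 v12] v02]] vt] c
  [[[[u0 u1] u2] [[u01 u12] u02]] ut] [[[[w0 w1] w2] [[w01 w12] w02]] wt].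
congr (_, (_, _, _), _) => /=; rewrite ?scale_mulPr ?scaler0 ?addr0 //.
rewrite rB.2 sB.2 !scaleP !scalerDr ![_ *: (c *: (_ : W))]scaleC.
by rewrite [RHS]addrACA; congr (_ + _); rewrite [RHS]addrACA.
Qed.

Lemma model_mul_linear x y : linear (fun a => model_mul a x y).
Proof.
case: x => [[[[x0 x1] x2] [[x01 x12] x02]] xt].
case: y => [[[[y0 y1] y2] [[y01 y12] y02]] yt] c a b.
congr (_, (_, _, _), _) => /=; rewrite ?scaler0 ?addr0 //.
- by rewrite scalerDr scaleC.
- by rewrite scalerDr scaleC.
- by rewrite scalerDr scaleC.
rewrite lB.1 rB.1 sB.1 !scalerDr.
rewrite [y2 *: (c *: _)]scaleC [x0 *: (c *: _)]scaleC [x1 *: (c *: _)]scaleC.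
by rewrite [RHS]addrACA; congr (_ + _); rewrite [RHS]addrACA.
Qed.

Lemma model_comp_r a b x y z :
  model_mul a x (model_mul b y z)
    = (0, 0, (x.1.1.1.1 * y.1.1.1.2 * z.1.1.2) *: r a b
             + (x.1.1.1.2 * y.1.1.1.1 * z.1.1.2) *: s a b).
Proof.
case: x => [[[[x0 x1] x2] [[x01 x12] x02]] xt].
case: y => [[[[y0 y1] y2] [[y01 y12] y02]] yt].
case: z => [[[[z0 z1] z2] [[z01 z12] z02]] zt] /=.
congr (_, (_, _, _), _) => /=; rewrite ?mulr0 ?scale0r //.
by rewrite add0r (bilinZr rB) (bilinZr sB) !scalerA !mulrA.
Qed.

Lemma model_comp_l a b x y z :
  model_mul a (model_mul b x y) z
    = (0, 0, (x.1.1.1.1 * y.1.1.1.2 * z.1.1.2) *: l a b).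
Proof.
case: x => [[[[x0 x1] x2] [[x01 x12] x02]] xt].
case: y => [[[[y0 y1] y2] [[y01 y12] y02]] yt].
case: z => [[[[z0 z1] z2] [[z01 z12] z02]] zt] /=.
congr (_, (_, _, _), _) => /=; rewrite ?mul0r ?scale0r //.
by rewrite !addr0 (bilinZr lB) !scalerA mulrC.
Qed.

Variable Phi : {linear tensor A A -> tensor A A}.
Hypothesis rE : forall a b t, Phi (tens a b) = tensor_of t ->
  r a b = \sum_(cd <- t) l cd.1 cd.2 + s b a.

(** Only the coefficients x0 y1 z2 and x1 y0 z2 occur, and (1 0) 2 = 0: comparing them gives [rE]
    for (a, b) and for (b, a). *)
Lemma model_prelie : prelie_algebra model_mul Phi.
Proof.
split=> [|a b t t' x y z tE t'E]; first exact: model_mul_linear.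
have cancel (p q u : W) : p + q + u - p = q + u.
  by rewrite [LHS]addrC !addrA addNr add0r.
have sumE u v w q : \sum_(cd <- q) model_mul cd.1 (model_mul cd.2 u v) w
    = (0, 0, (u.1.1.1.1 * v.1.1.1.2 * w.1.1.2) *: \sum_(cd <- q) l cd.1 cd.2).
  elim: q => [|cd q IHq]; first by rewrite !big_nil scaler0.
  rewrite !big_cons IHq model_comp_l scalerDr.
  by congr (_, _, _) => /=; rewrite addr0.
rewrite !sumE !model_comp_r (rE tE) (rE t'E).
congr (_, _, _) => //=; rewrite !scalerDr.
rewrite !cancel addrC; congr (_ *: _ + _ *: _).
  by rewrite [x.1.1.1.2 * _]mulrC.
by rewrite [x.1.1.1.1 * _]mulrC.
Qed.

Let mulDl a := bilinDl (model_mul_bilin a).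
Let mulDr a := bilinDr (model_mul_bilin a).
Let simp := (mul0r, mulr0, mul1r, scale0r, scale1r, addr0, add0r, subr0, sub0r).

Lemma NAP_binop_model a b : NAP_product (binop Phi a b) ->
  l b b = s a b /\ r a a = s a a.
Proof.
move=> pab.
have P x y z := NAP_binop_eval model_mul_bilin model_prelie x y z pab.
split.
  (* In this order the left side reduces to (0 1) 2 and the right side to 1 (0 2), with o_b as inner
     product. *)
  move: (P letter2 letter1 letter0) => /(congr1 snd).
  by rewrite !mulDl !mulDr !model_comp_r !model_comp_l /= !simp.
move: (P letter0 letter1 letter2) => /(congr1 snd).
by rewrite !mulDl !mulDr !model_comp_r !model_comp_l /= !simp.
Qed.

Lemma prelie_binop_model a b : prelie_product (binop Phi a b) ->
  r a b - s b a = l b a - s b b /\ r a a - l a a = s a a - l a b.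
Proof.
move=> pab.
have P x y z := prelie_binop_eval model_mul_bilin model_prelie x y z pab.
split.
  (* Each of the four surviving terms involves b; if l = 0 and s is the flip of r, all cancel but s
     b b. *)
  move: (P letter0 letter2 letter1) => /(congr1 snd).
  by rewrite !mulDl !mulDr !model_comp_r !model_comp_l /= !simp.
(* Here b enters only through the product of 1 and 0, which is 0 o_b 1. *)
move: (P letter0 letter1 letter2) => /(congr1 snd).
by rewrite !mulDl !mulDr !model_comp_r !model_comp_l /= !simp.
Qed.

End Model.

(** * Two choices of structure maps, and the classification *)

Section Classification.
Variables (K : fieldType) (A : lmodType K).
Variable Phi : {linear tensor A A -> tensor A A}.

Let assoc_r (a b : A) := Phi (tens a b).
Let zero_bilin (a b : A) : tensor A A := 0.
Let flip_tens (a b : A) := tens b a.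

Lemma assoc_r_bilin : bilin assoc_r.
Proof.
split=> [v c u u'|u c v v']; rewrite /assoc_r.
  by rewrite (tens_bilin A A).1 linearP.
by rewrite (tens_bilin A A).2 linearP.
Qed.

Lemma zero_bilinP : bilin zero_bilin.
Proof. by split=> [v c u u'|u c v v']; rewrite /zero_bilin scaler0 addr0. Qed.

Lemma flip_tens_bilin : bilin flip_tens.
Proof.
by have [tl tr] := tens_bilin A A; split=> [v|u]; [apply: tr|apply: tl].
Qed.

(** The Phi-associative model: l is the universal bilinear map, r is Phi and s is 0. *)
Lemma assoc_rE a b t : Phi (tens a b) = tensor_of t ->
  assoc_r a b = \sum_(cd <- t) tens cd.1 cd.2 + zero_bilin b a.
Proof. by rewrite addr0. Qed.

(** With l = 0 the condition becomes r a b = s b a, met by the tensor product and its flip for every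
    Phi. *)
Lemma flip_tensE a b t : Phi (tens a b) = tensor_of t ->
  tens a b = \sum_(cd <- t) zero_bilin cd.1 cd.2 + flip_tens b a.
Proof. by move=> _; rewrite big1 ?add0r. Qed.

Lemma NAP_binopE a b : NAP_product (binop Phi a b) ->
  b = 0 /\ special_vector Phi 0 a.
Proof.
move=> /(NAP_binop_model (tens_bilin A A) assoc_r_bilin zero_bilinP assoc_rE).
move=> [bb aa]; split; first exact: tens_diag_eq0.
by rewrite /special_vector scale0r.
Qed.

Lemma prelie_binopE a b : prelie_product (binop Phi a b) ->
  b = 0 /\ special_vector Phi 1 a.
Proof.
move=> pab; have b0 : b = 0.
  (* The flip model gives - b (x) b = 0. *)
  have [+ _] := prelie_binop_model zero_bilinP (tens_bilin A A) flip_tens_bilin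
    flip_tensE pab.
  rewrite /flip_tens /zero_bilin subrr sub0r => /esym/eqP.
  by rewrite oppr_eq0 => /eqP /tens_diag_eq0.
(* Once b = 0, the Phi-associative model gives Phi(a (x) a) - a (x) a = 0. *)
split=> //; have [_ aa] := prelie_binop_model (tens_bilin A A) assoc_r_bilin
  zero_bilinP assoc_rE pab.
move: aa; rewrite b0 (bilin0r (tens_bilin A A)) subr0 => /eqP.
by rewrite subr_eq0 /special_vector scale1r => /eqP.
Qed.

Lemma circ_prelie_product a :
  special_vector Phi 1 a -> prelie_product (circ Phi a).
Proof.
move=> aa; have aE : Phi (tens a a) = tensor_of [:: (a, a)].
  by rewrite aa scale1r /tensor_of big_seq1.
have := circ_prelie aE aE; rewrite !big_seq1 /prelie_product => ->.
by rewrite /op_act12 op_actB.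
Qed.

Lemma circ_NAP_product a : special_vector Phi 0 a -> NAP_product (circ Phi a).
Proof.
move=> aa; have aE : Phi (tens a a) = tensor_of [::].
  by rewrite aa scale0r /tensor_of big_nil.
by have := circ_prelie aE aE; rewrite !big_nil !subr0.
Qed.

End Classification.

Theorem proposition2p9 (K : fieldType) (charK : [pchar K] =i pred0)
    (A : lmodType K) (Phi : {linear tensor A A -> tensor A A})
    (hPhi : lCEDS Phi) :
  (forall p : PreLie Phi 'I_2,
     prelie_product p <-> exists a : A, special_vector Phi 1 a /\ p = circ Phi a)
  /\
  (forall p : PreLie Phi 'I_2,
     NAP_product p <-> exists a : A, special_vector Phi 0 a /\ p = circ Phi a).

Proof.
split=> p; split.
- have [a [b ->]] := binopP p => /prelie_binopE [-> aa].
  by exists a; rewrite binop0.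
- by move=> [a [aa ->]]; apply: circ_prelie_product.
- have [a [b ->]] := binopP p => /NAP_binopE [-> aa].
  by exists a; rewrite binop0.
by move=> [a [aa ->]]; apply: circ_NAP_product.
Qed.
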